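(* Let $a\in(-1,1)$ and let $H$ be the operator in $L^2((-\frac{\pi}{2},\frac{\pi}{2}))$ defined by $H\psi=-\psi''$ on the domain $\mathsf{D}(H)=\{\psi\in H^2((-\frac{\pi}{2},\frac{\pi}{2})) : \psi(-\frac{\pi}{2})=\psi(\frac{\pi}{2}a)=\psi(\frac{\pi}{2})\}$. Set $$\sigma_{\pm1}=\Big\{\Big(\frac{4m}{1\pm a}\Big)^2 : m\in\mathbb{N}^*\Big\},\qquad \sigma_0=\{(2m)^2 : m\in\mathbb{N}\}.$$ Then the point spectrum of $H$ is $\sigma_{\mathrm p}(H)=\sigma_{-1}\cup\sigma_{+1}\cup\sigma_0$. Moreover: 1. If $a\notin\mathbb{Q}$, then the sets $\sigma_{-1}$, $\sigma_{+1}$ and $\sigma_0$ are mutually disjoint and each point of the point spectrum is an eigenvalue of $H$ of geometric multiplicity one. The associated eigenfunction is, up to a non-zero multiplicative constant, (i) $\cos\big(\frac{4m}{1-a}x\big)$ for the eigenvalue $\big(\frac{4m}{1-a}\big)^2\in\sigma_{-1}$, $m\in\mathbb{N}^*$; (ii) $\cos\big(\frac{4m}{1+a}x\big)$ for the eigenvalue $\big(\frac{4m}{1+a}\big)^2\in\sigma_{+1}$, $m\in\mathbb{N}^*$; (iii) $\cos(2mx)+\frac{\cos(m\pi)-\cos(m\pi a)}{\sin(m\pi a)}\sin(2mx)$ for the eigenvalue $(2m)^2\in\sigma_0$, $m\in\mathbb{N}^*$; (iv) the constant function $1$ for the eigenvalue $0\in\sigma_0$. 2. If $a\in\mathbb{Q}$,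 then $\sigma_{-1}\cap\sigma_{+1}=\sigma_{-1}\cap\sigma_{+1}\cap\sigma_0\neq\varnothing$. Each point $\lambda=k^2$, $k>0$, of $\sigma_{-1}\cap\sigma_{+1}$ is an eigenvalue of $H$ of geometric multiplicity two, with the two linearly independent associated eigenfunctions $\sin(kx)$ and $\cos(kx)$. Each point of $\sigma_{\mathrm p}(H)\setminus(\sigma_{-1}\cap\sigma_{+1})$ is an eigenvalue of geometric multiplicity one; the associated eigenfunction is, up to a non-zero multiplicative constant, the function in (i) for an eigenvalue $\big(\frac{4m}{1-a}\big)^2\in\sigma_{-1}$, the function in (ii) for an eigenvalue $\big(\frac{4m}{1+a}\big)^2\in\sigma_{+1}$, the function in (iii) for an eigenvalue $(2m)^2\in\sigma_0$ with $m\in\mathbb{N}^*$ and $ma\notin\mathbb{Z}$, the function $\sin(2mx)$ for an eigenvalue $(2m)^2\in\sigma_0$ with $m\in\mathbb{N}^*$, $ma\in\mathbb{Z}$ and $m(1+a)$ odd, and the constant function $1$ for the eigenvalue $0$ (which is always geometrically simple).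
   Context: $\mathbb{N}=\{0,1,2,\dots\}$ and $\mathbb{N}^*=\mathbb{N}\setminus\{0\}$. $L^2((-\frac{\pi}{2},\frac{\pi}{2}))$ is the complex Hilbert space of square-integrable functions and $H^2$ denotes the usual Sobolev space, whose elements are identified with their continuous representatives on $[-\frac{\pi}{2},\frac{\pi}{2}]$. The point spectrum $\sigma_{\mathrm p}(H)$ is the set of eigenvalues of $H$; the geometric multiplicity of an eigenvalue $\lambda$ is $\dim\ker(H-\lambda)$. *)

(* Defs.v *)
From mathcomp Require Import all_boot all_order all_algebra.
From mathcomp Require Export complex.
From mathcomp Require Import all_classical all_reals all_analysis.

Set Implicit Arguments.
Unset Strict Implicit.
Unset Printing Implicit Defensive.

Import Order.TTheory GRing.Theory Num.Theory.
Import numFieldNormedType.Exports.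

Local Open Scope classical_set_scope.
Local Open Scope ring_scope.
Local Open Scope complex_scope.

Section Dimension.
Context {K : fieldType} {U : lmodType K}.

Definition lin_comb (s : seq U) (c : 'I_(size s) -> K) : U :=
  \sum_(i < size s) c i *: s`_i.

Definition lin_indep (s : seq U) : Prop :=
  forall c : 'I_(size s) -> K, lin_comb c = 0 -> forall i, c i = 0.

Definition has_dim (V : set U) (n : nat) : Prop :=
  exists s : seq U, [/\ size s = n, lin_indep s & V = range (@lin_comb s)].

End Dimension.

Section Operator.
Context {R : realType}.
Implicit Types (f g h u psi : R -> R[i]) (phi : R -> R) (a : R) (lambda : R[i]).

Definition oitv : set R := `]- (pi / 2), pi / 2[.
Definition citv : set R := `[- (pi / 2), pi / 2].

Definition cintegral f : R[i] :=
  (\int[lebesgue_measure]_(x in oitv) complex.Re (f x))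
    +i* (\int[lebesgue_measure]_(x in oitv) complex.Im (f x)).

Definition L2 f : Prop :=
  [/\ measurable_fun oitv (fun x => complex.Re (f x)),
      measurable_fun oitv (fun x => complex.Im (f x)) &
      (\int[lebesgue_measure]_(x in oitv)
         (complex.Re (f x) ^+ 2 + complex.Im (f x) ^+ 2)%:E < +oo)%E].

(* The space C_c^oo(oitv).  Real-valued test functions suffice to define weak
   derivatives of complex-valued functions, by linearity. *)
Definition test_function phi : Prop :=
  (forall (n : nat) (x : R), derivable (derive1n n phi) x 1) /\
  exists K : set R, [/\ compact K, K `<=` oitv & forall x, ~ K x -> phi x = 0].

Definition weak_deriv u g : Prop :=
  forall phi, test_function phi ->
    cintegral (fun x => u x * (derive1 phi x)%:C) =
    - cintegral (fun x => g x * (phi x)%:C).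

Definition weak_deriv2 u h : Prop :=
  exists g, [/\ L2 g, weak_deriv u g & weak_deriv g h].

Definition H2 u : Prop := L2 u /\ exists2 h, L2 h & weak_deriv2 u h.

(* An element of H^2 is identified with its continuous representative on the
   closed interval.  Setting it to 0 outside turns such representatives into
   elements of the complex vector space R -> R[i], so that an L^2 class
   corresponds to exactly one function and vanishes iff that function does. *)
Definition cont_repr psi : Prop :=
  {within citv, continuous (psi : R -> R[i]^o)} /\
  forall x, ~ citv x -> psi x = 0.

Definition domH a : set (R -> R[i]) := [set psi |
  [/\ H2 psi, cont_repr psi,
      psi (- (pi / 2)) = psi (pi / 2 * a) &
      psi (pi / 2 * a) = psi (pi / 2)]].

(* The graph of H : f is any representative of the L^2 class - psi''. *)
Definition graphH a psi f : Prop :=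
  [/\ domH a psi, L2 f & weak_deriv2 psi (- f)].

Definition kerH a lambda : set (R -> R[i]) :=
  [set psi | graphH a psi (lambda *: psi)].

Definition eigenfunction a lambda psi : Prop :=
  kerH a lambda psi /\ psi <> 0.

Definition point_spectrum a : set R[i] :=
  [set lambda | exists psi, eigenfunction a lambda psi].

Definition geom_mult a lambda (n : nat) : Prop := has_dim (kerH a lambda) n.

Definition on_citv phi : R -> R[i] := patch (fun=> 0) citv (fun x => (phi x)%:C).

(* Up to a nonzero multiplicative constant, phi is the associated
   eigenfunction. *)
Definition unique_eigenfunction a lambda phi : Prop :=
  forall psi, eigenfunction a lambda psi <->
    exists2 c : R[i], c != 0 & psi = c *: on_citv phi.

Definition sigma_m1 a : set R[i] :=
  [set ((4 * m%:R / (1 - a)) ^+ 2)%:C | m in [set m : nat | (0 < m)%N]].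
Definition sigma_p1 a : set R[i] :=
  [set ((4 * m%:R / (1 + a)) ^+ 2)%:C | m in [set m : nat | (0 < m)%N]].
Definition sigma_0 : set R[i] :=
  [set ((2 * m%:R) ^+ 2 : R)%:C | m in [set: nat]].

Definition cos_m1 a (m : nat) : R -> R :=
  fun x => cos (4 * m%:R / (1 - a) * x).
Definition cos_p1 a (m : nat) : R -> R :=
  fun x => cos (4 * m%:R / (1 + a) * x).
Definition mixed_0 a (m : nat) : R -> R :=
  fun x => cos (2 * m%:R * x) +
    (cos (m%:R * pi) - cos (m%:R * pi * a)) / sin (m%:R * pi * a)
      * sin (2 * m%:R * x).

End Operator.

(* Main.v *)
(* A weak solution psi of - psi'' = lambda psi is classical: if P is a second
   primitive of - lambda psi, then psi - P is continuous and orthogonal to the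
   second derivatives of all test functions, and testing against three shrinking
   bumps with weights annihilating affine functions shows that it is affine.
   Hence psi = A exp(ikx) + B exp(-ikx) with k^2 = lambda (affine if lambda = 0).
   With z = exp(ik pi/2) and w = exp(ik a pi/2), the boundary conditions force
   z^2 = 1, or A = B together with (z - w)(zw - 1) = 0; in each case k is real and
   lies in one of the three families.  For real k > 0, everything is then read off
   from the zeros of sin u, sin v and sin (u + v), where u + v = k pi/2 and
   u - v = k a pi/2. *)

Require Import Defs.
From mathcomp Require Import all_boot all_order all_algebra.
From mathcomp Require Import complex.
From mathcomp Require Import all_classical all_reals all_analysis.
From mathcomp Require Import ring lra.
Import Order.TTheory GRing.Theory Num.Theory.
Import numFieldNormedType.Exports.
Local Open Scope classical_set_scope.
Local Open Scope ring_scope.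
Local Open Scope complex_scope.
Set Implicit Arguments.
Unset Strict Implicit.
Unset Printing Implicit Defensive.

(** * Smooth bump functions *)

(** The parameter [lambda] ranges over all complex numbers, and reality of the eigenvalues is not
    drawn from any symmetry of the operator. It is computed: every branch of the boundary conditions
    ends in [exp(ikx) = 1] for some real [x > 0], and the modulus of this identity forces
    [Im k = 0]. For real [k > 0] the solution [A cos(kx) + B sin(kx)] obeys the boundary conditions
    exactly when [B sin(u + v) = 0] and [-2 A sin u sin v = B sin(u - v)]. All multiplicities and
    eigenfunctions are cases of this linear system. The arithmetic of the three families rests on
    one fact: if two of [sin u], [sin v], [sin (u + v)] vanish, so does the third. Hence an
    intersection of two families, away from [0], is the intersection of all three; and
    [sin u = sin v = 0] makes [(1 + a) / (1 - a)] a quotient of positive integers, which is where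
    rationality of [a] enters. The analytic obstacle is that the kernel is described by smooth test
    functions only, so bumps with all derivatives have to be built before any regularity can be
    proved. *)

Section SmoothFunctions.
Context {R : realType}.
Implicit Types (f g : R -> R) (p : {poly R}) (x : R).

Lemma is_derive_sum_fun f g (x df dg : R) :
  is_derive x 1 f df -> is_derive x 1 g dg ->
  is_derive x 1 (fun y => f y + g y) (df + dg).
Proof. exact: is_deriveD. Qed.

Lemma is_derive_mul_fun f g (x df dg : R) :
  is_derive x 1 f df -> is_derive x 1 g dg ->
  is_derive x 1 (fun y => f y * g y) (df * g x + f x * dg).
Proof.
move=> hf hg; apply: is_derive_eq (is_deriveM hf hg) _.
by rewrite /GRing.scale /= addrC [g x * _]mulrC.
Qed.

Lemma is_derive_comp_fun f g (x df dg : R) :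
  is_derive (g x) 1 f df -> is_derive x 1 g dg ->
  is_derive x 1 (fun y => f (g y)) (df * dg).
Proof. exact: is_derive1_comp. Qed.

Lemma is_derive_affine (a b x : R) : is_derive x 1 (fun y => a * y + b) a.
Proof.
have dM := is_derive_mul_fun (is_derive_cst a x 1) (is_derive_id x 1).
apply: is_derive_eq (is_derive_sum_fun dM (is_derive_cst b x 1)) _.
by rewrite /cst mul0r add0r mulr1 addr0.
Qed.

Lemma is_derive1_fun f (x df : R) : is_derive x 1 f df -> derive1 f x = df.
Proof. by move=> ?; rewrite derive1E derive_val. Qed.

Lemma derivable_is_derive1 f (x : R) : derivable f x 1 -> is_derive x 1 f (derive1 f x).
Proof. by move=> ?; rewrite derive1E; apply: derivableP. Qed.

Definition smooth f := forall n (x : R), derivable (derive1n n f) x 1.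

(** Coinduction for smoothness. Peeling the innermost derivative off the iterate lets [f] change
    while the class [P] stays fixed, so no formula for higher derivatives is needed. *)
Lemma smooth_coind (P : (R -> R) -> Prop) :
  (forall f, P f -> (forall x : R, derivable f x 1) /\ P (derive1 f)) ->
  forall f, P f -> smooth f.
Proof.
move=> H f Pf n; elim: n f Pf => [|n IH] f Pf x; first exact: (H f Pf).1.
by rewrite derive1Sn; apply: IH; exact: (H f Pf).2.
Qed.

Lemma smooth_derivable f : smooth f -> forall x : R, derivable f x 1.
Proof. by move=> sf; exact: (sf 0%N). Qed.

Lemma smooth_is_derive f : smooth f -> forall x, is_derive x 1 f (derive1 f x).
Proof. by move=> sf x; apply/derivable_is_derive1/smooth_derivable. Qed.

Lemma smooth_derive f : smooth f -> smooth (derive1 f).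
Proof. by move=> sf n x; rewrite -derive1Sn; exact: sf. Qed.

Lemma smooth_primitive f g : (forall x, is_derive x 1 f (g x)) -> smooth g -> smooth f.
Proof.
move=> fg sg [|n] x; first by case: (fg x).
rewrite derive1Sn (_ : derive1 f = g); first exact: sg.
by apply/funext => y; exact: is_derive1_fun.
Qed.

Lemma smooth_continuous f : smooth f -> continuous f.
Proof. by move=> sf x; apply/differentiable_continuous/derivable1_diffP/smooth_derivable. Qed.

(* Closing the smooth functions under the operations below and differentiating
   inside that closure avoids a Leibniz formula for the n-th derivative. *)
Inductive smooth_closure : (R -> R) -> Prop :=
| SC_smooth f : smooth f -> smooth_closure f
| SC_cst (c : R) : smooth_closure (cst c)
| SC_add f g : smooth_closure f -> smooth_closure g ->
    smooth_closure (fun x => f x + g x)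
| SC_mul f g : smooth_closure f -> smooth_closure g ->
    smooth_closure (fun x => f x * g x)
| SC_affine f (a b : R) : smooth_closure f ->
    smooth_closure (fun x => f (a * x + b)).

Lemma smooth_closureP f : smooth_closure f -> smooth f.
Proof.
apply: smooth_coind => {}f; elim=> {f}.
- move=> f sf; split; first exact: smooth_derivable.
  exact/SC_smooth/smooth_derive.
- move=> c; split=> //.
  rewrite (_ : derive1 _ = cst 0); first exact: SC_cst.
  by apply/funext => x; apply: is_derive1_fun; exact: is_derive_cst.
- move=> f g _ [df Sf] _ [dg Sg].
  have D x := is_derive_sum_fun (derivable_is_derive1 (df x)) (derivable_is_derive1 (dg x)).
  split=> [x|]; first by case: (D x).
  rewrite (_ : derive1 _ = fun x => derive1 f x + derive1 g x); first exact: SC_add.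
  by apply/funext => x; exact: is_derive1_fun.
- move=> f g Af [df Sf] Ag [dg Sg].
  have D x := is_derive_mul_fun (derivable_is_derive1 (df x)) (derivable_is_derive1 (dg x)).
  split=> [x|]; first by case: (D x).
  rewrite (_ : derive1 _ = fun x => derive1 f x * g x + f x * derive1 g x).
    by apply: SC_add; exact: SC_mul.
  by apply/funext => x; exact: is_derive1_fun.
- move=> f a b Af [df Sf].
  have D x := is_derive_comp_fun (g := fun y => a * y + b)
    (derivable_is_derive1 (df (a * x + b))) (is_derive_affine a b x).
  split=> [x|]; first by case: (D x).
  rewrite (_ : derive1 _ = fun x => derive1 f (a * x + b) * cst a x).
    by apply: SC_mul; [exact: (SC_affine a b Sf) | exact: SC_cst].
  by apply/funext => x; apply: is_derive1_fun; exact: D.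
Qed.

Lemma smooth_add f g : smooth f -> smooth g -> smooth (fun x => f x + g x).
Proof. by move=> sf sg; apply/smooth_closureP/SC_add; exact: SC_smooth. Qed.

Lemma smooth_mul f g : smooth f -> smooth g -> smooth (fun x => f x * g x).
Proof. by move=> sf sg; apply/smooth_closureP/SC_mul; exact: SC_smooth. Qed.

Lemma smooth_cst (c : R) : smooth (cst c).
Proof. exact/smooth_closureP/SC_cst. Qed.

Lemma smooth_affine f (a b : R) : smooth f -> smooth (fun x => f (a * x + b)).
Proof. by move=> sf; apply/smooth_closureP/SC_affine; exact: SC_smooth. Qed.

(** The bound gives [f 0 = 0] and a difference quotient of size at most [C |h|]. This settles the
    gluing point of the flat functions. *)
Lemma is_derive_quadratic_bound f (C : R) :
  (forall x, `|f x| <= C * x ^+ 2) -> is_derive (0 : R) 1 f 0.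
Proof.
move=> fC.
have f0 : f 0 = 0.
  by apply/eqP; rewrite -normr_le0 (le_trans (fC 0))// expr0n mulr0.
have C0 : 0 <= C by have := fC 1; rewrite expr1n mulr1; exact: le_trans.
have H : h^-1 *: (f (h *: 1 + 0) - f 0) @[h --> 0^'] --> (0 : R).
  (* [C] may be zero; [C + 1] can be divided by. *)
  have C1 : 0 < C + 1 by rewrite ltr_wpDl.
  apply/cvgr0Pnorm_le => e e0.
  near=> h.
  have h0 : h != 0 by near: h; exact: nbhs_dnbhs_neq.
  rewrite f0 subr0 addr0 /GRing.scale /= mulr1 normrM normfV.
  rewrite ler_pdivrMl ?normr_gt0// (le_trans (fC h))// -(real_normK (num_real h)) expr2.
  rewrite mulrCA ler_wpM2l// (@le_trans _ _ ((C + 1) * `|h|))//.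
    by rewrite ler_wpM2r// ler_wpDr.
  rewrite -ler_pdivlMl// mulrC ltW//; near: h.
  apply: dnbhs0_lt; exact: divr_gt0.
split; first by apply/cvg_ex; exists 0.
by apply/cvg_lim.
Unshelve. all: by end_near. Qed.

(** Termwise, [y ^ i <= i! exp y] by the exponential series, which yields the constant as the sum of
    [|p_i| i!]. *)
Lemma horner_expR_bound p :
  exists2 C : R, 0 <= C & forall y, 0 <= y -> `|p.[y]| <= C * expR y.
Proof.
exists (\sum_(i < size p) `|p`_i| * (i`!)%:R).
  by apply: sumr_ge0 => i _; rewrite mulr_ge0.
move=> y y0; rewrite horner_coef mulr_suml (le_trans (ler_norm_sum _ _ _))//.
apply: ler_sum => i _; rewrite normrM -mulrA ler_wpM2l// ger0_norm ?exprn_ge0//.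
rewrite -ler_pdivrMl ?ltr0n ?fact_gt0// mulrC.
case: (i : nat) => [|k].
  by rewrite expr0 fact0 divr1 -[leLHS]expR0 ler_expR.
by apply: le_trans (expR_ge1Dxn k y0); rewrite ler_wpDl.
Qed.

(** The classical flat function [exp(-1/x)], with a polynomial factor in [1/x] so that the family is
    stable under differentiation. *)
Definition flat p : R -> R := fun x => if 0 < x then p.[x^-1] * expR (- x^-1) else 0.

(** With [y = 1/x] one has [d/dx = - y^2 d/dy], and [d/dy] sends [p(y) exp(-y)] to
    [(p' - p)(y) exp(-y)]. *)
Lemma is_derive_flat p x : is_derive x 1 (flat p) (flat ((p - p^`()) * 'X^2) x).
Proof.
have [x0|x0|<-] := ltgtP 0 x.
- have x1 : x != 0 by rewrite gt_eqF.
  have dV : is_derive x 1 (fun y : R => y^-1) (- x ^- 2).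
    by apply: is_derive_eq (is_deriveV x1 (is_derive_id x 1)) _; rewrite /GRing.scale /= mulr1.
  have dp := is_derive_comp_fun (g := fun y => y^-1) (is_derive_poly p x^-1) dV.
  have dN : is_derive x 1 (fun y : R => - y^-1) (x ^- 2).
    by apply: is_derive_eq (is_deriveN dV) _; rewrite opprK.
  have dE := is_derive_comp_fun (g := fun y => - y^-1) (is_derive_expR (- x^-1)) dN.
  apply: (near_eq_is_derive _ (is_derive_eq (is_derive_mul_fun dp dE) _)).
    near=> y; rewrite /flat ifT//; near: y; exact: lt_nbhsr.
  by rewrite /flat x0 !(hornerE, hornerXn) /= expr2 invfM; ring.
- have D0 : is_derive x 1 (cst (0 : R)) 0 := is_derive_cst _ _ _.
  apply: (near_eq_is_derive _ (is_derive_eq D0 _)).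
    near=> y; rewrite /flat ifF//; apply: le_gtF; apply: ltW; near: y; exact: lt_nbhsl.
  by rewrite /flat le_gtF// ltW.
- rewrite [X in is_derive _ _ _ X](_ : _ = 0); last by rewrite /flat ltxx.
  (* The extra factor ['X^2] is what supplies the quadratic bound: [|p(1/y)| y^-2 <= C exp(1/y)],
     that is, [|flat p y| <= C y^2] for [y > 0]. *)
  have [C C0 HC] := horner_expR_bound (p * 'X^2).
  apply: (is_derive_quadratic_bound (C := C)) => y; rewrite /flat.
  case: ifPn => [y0|_]; last by rewrite normr0 mulr_ge0// sqr_ge0.
  have y1 : y != 0 by rewrite gt_eqF.
  have y2 : 0 <= y^-1 by rewrite invr_ge0 ltW.
  have := HC _ y2; rewrite hornerM hornerXn normrM [`|_ ^+ 2|]ger0_norm ?sqr_ge0//.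
  rewrite exprVn ler_pdivrMr ?exprn_gt0// => H.
  rewrite normrM [`|expR _|]ger0_norm ?expR_ge0// expRN ler_pdivrMr ?expR_gt0//.
  by rewrite mulrAC.
Unshelve. all: by end_near. Qed.

Lemma smooth_flat p : smooth (flat p).
Proof.
apply: (smooth_coind (P := fun f => exists q, f = flat q)); last by exists p.
move=> _ [q ->]; split=> [x|]; first by case: (is_derive_flat q x).
exists ((q - q^`()) * 'X^2); apply/funext => x.
by apply: is_derive1_fun; exact: is_derive_flat.
Qed.

Lemma smooth_bump (d : R) : 0 < d ->
  exists eta, [/\ smooth eta, forall x, 0 <= eta x,
    forall x, d <= `|x| -> eta x = 0 & forall x, `|x| < d -> 0 < eta x].
Proof.
(* One factor vanishes for [x <= -d], the other for [x >= d]; between these points both are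
   positive. *)
move=> d0; exists (fun x => flat 1 (1 * x + d) * flat 1 (-1 * x + d)).
have F x : 0 <= flat 1 x by rewrite /flat; case: ifP => // _; rewrite hornerC mul1r expR_ge0.
split.
- by apply: smooth_mul; apply: smooth_affine; exact: smooth_flat.
- by move=> x; rewrite mulr_ge0.
- move=> x; rewrite ler_normr => /orP[] dx; rewrite /flat.
    by rewrite [X in _ * X]ifF ?mulr0//; apply: le_gtF; lra.
  by rewrite [X in X * _]ifF ?mul0r//; apply: le_gtF; lra.
- move=> x; rewrite ltr_norml => /andP[? ?]; rewrite /flat !ifT; [|lra|lra].
  by rewrite !hornerC !mul1r mulr_gt0// expR_gt0.
Qed.

End SmoothFunctions.

(** * Primitives and test functions *)

Section Primitives.
Context {R : realType}.
Implicit Types (f g F phi eta : R -> R) (x a b : R).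
Local Notation mu := (@lebesgue_measure R).

Lemma is_derive_continuous F f :
  (forall x, is_derive x 1 F (f x)) -> continuous F.
Proof.
by move=> dF x; apply/differentiable_continuous/derivable1_diffP; case: (dF x).
Qed.

Lemma continuous_integrable f a b : continuous f ->
  mu.-integrable `[a, b] (EFin \o f).
Proof.
move=> cf; apply: continuous_compact_integrable; first exact: segment_compact.
exact: continuous_subspaceT.
Qed.

Lemma Rintegral_ftc F f a b : a < b ->
  (forall x, is_derive x 1 F (f x)) -> continuous f ->
  \int[mu]_(x in `[a, b]) f x = F b - F a.
Proof.
move=> ab dF cf; rewrite /Rintegral (@continuous_FTC2 _ f F a b ab) //.
- exact: continuous_subspaceT.
- have cF := is_derive_continuous dF; split.
  + by move=> x _; case: (dF x).
  + exact/cvg_at_right_filter/cF.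
  + exact/cvg_at_left_filter/cF.
- by move=> x _; exact: is_derive1_fun.
Qed.

Lemma is_derive0_itv F f a b : a <= b ->
  (forall x, is_derive x 1 F (f x)) -> {in `]a, b[, forall x, f x = 0} -> F a = F b.
Proof.
rewrite le_eqVlt => /predU1P[-> //|ab] dF f0.
have [c cab] := MVT ab (fun x _ => dF x)
  (continuous_subspaceT (is_derive_continuous dF)).
by rewrite f0// mul0r => /eqP; rewrite subr_eq0 => /eqP.
Qed.

Lemma Rintegral_primitive_gt f a x : continuous f -> a < x ->
  is_derive x 1 (fun y => \int[mu]_(t in `[a, y]) f t) (f x).
Proof.
move=> cf ax.
have xu : x < x + 1 by rewrite ltrDl.
have [D E] := continuous_FTC1_closed xu (continuous_integrable a (x + 1) cf) ax (cf x).
by rewrite -E; exact: derivable_is_derive1.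
Qed.

Lemma primitive_on_ray f a : continuous f ->
  exists F, forall x, a < x -> is_derive x 1 F (f x).
Proof.
by move=> cf; exists (fun y => \int[mu]_(t in `[a, y]) f t) => x; exact: Rintegral_primitive_gt.
Qed.

(** Integrating from [-n] gives a primitive only to the right of [-n]. Normalised to vanish at [0],
    these primitives agree wherever two of them are defined, so they glue to one on the whole
    line. *)
Lemma primitive f : continuous f -> exists F, forall x, is_derive x 1 F (f x).
Proof.
move=> cf.
have [G GP] := choice (fun n : nat => primitive_on_ray (- n%:R) cf).
pose H n x := G n x - G n 0.
have HP n x : - n%:R < x -> is_derive x 1 (H n) (f x).
  move=> nx; apply: is_derive_eq (is_derive_sum_fun (GP n x nx)
    (is_derive_cst (- G n 0) x 1)) _.
  by rewrite addr0.
have Hmn m n x : (m <= n)%N -> (0 < m)%N -> - m%:R < x -> H m x = H n x.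
  move=> mn m0 mx.
  have nm : - n%:R <= - m%:R :> R by rewrite lerN2 ler_nat.
  have D (y : R) : - m%:R < y -> is_derive y 1 (fun z => H m z - H n z) 0.
    move=> my; apply: is_derive_eq (is_deriveB (HP m y my) (HP n y _)) _.
      exact: le_lt_trans my.
    by rewrite subrr.
  have C a b : - m%:R < a -> a < b -> H m a - H n a = H m b - H n b.
    move=> ma ab.
    have cc : {within `[a, b], continuous (fun z => H m z - H n z)}.
      apply: derivable_within_continuous => z /[!in_itv]/= /andP[az _].
      by case: (D z (lt_le_trans ma az)).
    have [c _] := MVT ab (fun x (h : x \in `]a, b[) => D x
      ltac:(by move: h; rewrite in_itv/= => /andP[+ _]; exact: lt_trans)) cc.
    by rewrite mul0r => /eqP; rewrite subr_eq0 => /eqP.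
  have M0 : - m%:R < 0 :> R by rewrite oppr_lt0 ltr0n.
  apply/eqP; rewrite -subr_eq0; apply/eqP.
  have H0 : H m 0 - H n 0 = 0 by rewrite /H !subrr.
  by have [x0|x0|->//] := ltgtP x 0; rewrite -[RHS]H0; [|symmetry]; exact: C.
pose N x := (Num.truncn `|x|).+1.
have NP x : - (N x)%:R < x by apply: ltrNnormlW; exact: truncnS_gt.
exists (fun x => H (N x) x) => x.
(* The index [N] jumps, so near [x] the glued function is compared with the single primitive of
   index [(N x).+1]. *)
apply: (near_eq_is_derive _ (HP (N x).+1 x _)); last first.
  by apply: le_lt_trans (NP x); rewrite lerN2 ler_nat.
near=> y.
have yN : - (N x).+1%:R < y.
  near: y; apply: lt_nbhsr.
  by apply: le_lt_trans (NP x); rewrite lerN2 ler_nat.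
by have [?|/ltnW ?] := leqP (N x).+1 (N y); [|symmetry]; exact: Hmn.
Unshelve. all: by end_near. Qed.


(* Since [EE] is affine to the right of the support of [eta], a combination of
   translates of [EE] whose weights annihilate affine functions is a test function. *)
Lemma bump_primitives (d : R) : 0 < d -> exists eta E EE (I c : R),
  [/\ [/\ smooth eta, smooth E & smooth EE],
      (forall x, is_derive x 1 EE (E x)) /\ (forall x, is_derive x 1 E (eta x)),
      0 < I /\ (forall x, 0 <= eta x),
      forall x, d <= `|x| -> eta x = 0 &
      (forall x, x <= - d -> E x = 0 /\ EE x = 0) /\
      (forall x, d <= x -> E x = I /\ EE x = I * x + c)].
Proof.
move=> d0; have [eta [s_eta eta_ge0 eta0 eta_gt0]] := smooth_bump d0.
have prim0 f : continuous f -> exists F, (forall x, is_derive x 1 F (f x)) /\ F (- d) = 0.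
  move=> cf; have [F FP] := primitive cf; exists (fun x => F x + - F (- d)).
  split=> [x|]; last by rewrite subrr.
  apply: is_derive_eq (is_derive_sum_fun (FP x) (is_derive_cst (- F (- d)) x 1)) _.
  by rewrite addr0.
have [E [dE E0]] := prim0 _ (smooth_continuous s_eta).
have sE : smooth E := smooth_primitive dE s_eta.
have [EE [dEE EE0]] := prim0 _ (smooth_continuous sE).
have El x : x <= - d -> E x = 0.
  move=> xd; rewrite -E0; apply: (is_derive0_itv xd dE) => y /[!in_itv]/= /andP[_ yd].
  by apply: eta0; rewrite ler_normr; apply/orP; right; lra.
have Er x : d <= x -> E x = E d.
  move=> xd; symmetry; apply: (is_derive0_itv xd dE) => y /[!in_itv]/= /andP[yd _].
  by apply: eta0; rewrite ler_normr (ltW yd).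
have dd : - d < d by rewrite gtrN.
(* [I = E d] is the total mass of [eta], hence the slope of [EE] beyond [d]; [c] is the intercept of
   that line. *)
exists eta, E, EE, (E d), (EE d - E d * d).
have sEE : smooth EE := smooth_primitive dEE sE.
split; [by []|by []| |exact: eta0|].
- split; last exact: eta_ge0.
  have [c cd] := MVT dd (fun x _ => dE x) (continuous_subspaceT (smooth_continuous sE)).
  rewrite E0 subr0 => ->; apply: mulr_gt0; last by rewrite subr_gt0.
  by apply: eta_gt0; rewrite ltr_norml; move: cd; rewrite in_itv.
- split=> x xd; split; [exact: El| |exact: Er|].
    rewrite -EE0; apply: (is_derive0_itv xd dEE) => y /[!in_itv]/= /andP[_ yd].
    exact/El/ltW.
  have D (y : R) : is_derive y 1 (fun z => EE z - (E d * z + 0)) (E y - E d).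
    exact: is_deriveB (dEE y) (is_derive_affine (E d) 0 y).
  have := is_derive0_itv xd D => H.
  have : EE d - (E d * d + 0) = EE x - (E d * x + 0).
    apply: H => y /[!in_itv]/= /andP[yd _]; by rewrite Er ?subrr// ltW.
  by rewrite !addr0 => ->; rewrite addrC subrK.
Qed.

End Primitives.

(** * Integration against test functions and second differences *)

Section TestFunctions.
Context {R : realType}.
Implicit Types (f g F u phi eta : R -> R) (x a b y : R).
Local Notation mu := (@lebesgue_measure R).
Local Notation h := (pi / 2 : R).

Lemma pihalf_lt : - h < h.
Proof. have := pi_gt0 R; lra. Qed.

Lemma oitvE x : oitv x <-> - h < x < h.
Proof. by rewrite /oitv /= in_itv. Qed.

Lemma citvE x : citv x <-> - h <= x <= h.
Proof. by rewrite /citv /= in_itv. Qed.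

Lemma oitv_citv x : oitv x -> citv x.
Proof. by rewrite oitvE citvE => /andP[/ltW -> /ltW ->]. Qed.

Lemma measurable_oitv : measurable (oitv : set (measurableTypeR R)).
Proof. exact: measurable_itv. Qed.

Lemma integrable_oitv f : continuous f -> mu.-integrable oitv (EFin \o f).
Proof.
move=> cf; apply: integrableS (continuous_integrable (- h) h cf) => //.
  exact: measurable_oitv.
exact: subset_itv_oo_cc.
Qed.

Lemma Rintegral_oitv f : continuous f ->
  \int[mu]_(x in oitv) f x = \int[mu]_(x in citv) f x.
Proof.
move=> cf; have ci := continuous_integrable (- h) h cf.
rewrite /oitv Rintegral_itv_obnd_cbnd ?Rintegral_itv_bndo_bndc//.
  apply: integrableS ci => // x /=.
  by rewrite !in_itv /= => /andP[-> /ltW ->].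
exact: integrable_oitv.
Qed.

Lemma Rintegral_oitv_ftc F f :
  (forall x, is_derive x 1 F (f x)) -> continuous f ->
  \int[mu]_(x in oitv) f x = F h - F (- h).
Proof.
by move=> dF cf; rewrite Rintegral_oitv// (Rintegral_ftc pihalf_lt dF).
Qed.

Lemma continuousM_fun f g : continuous f -> continuous g ->
  continuous (fun x => f x * g x).
Proof. by move=> cf cg x; apply: cvgM; [exact: cf|exact: cg]. Qed.

Lemma continuousD_fun f g : continuous f -> continuous g ->
  continuous (fun x => f x + g x).
Proof. by move=> cf cg x; apply: cvgD; [exact: cf|exact: cg]. Qed.

Lemma test_smooth phi : test_function phi -> smooth phi.
Proof. by case. Qed.

Lemma test_function_out phi x : test_function phi -> ~ oitv x -> phi x = 0.
Proof. by move=> [_ [K [_ Koi K0]]] xo; apply: K0 => /Koi. Qed.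

(** The same compact set serves: its complement is open, so [phi] vanishes in a neighbourhood of
    each outer point and its derivative is zero there. *)
Lemma test_function_derive phi : test_function phi -> test_function (derive1 phi).
Proof.
move=> tphi; have [_ [K [cK Koi K0]]] := tphi.
split; first exact/smooth_derive/test_smooth.
exists K; split=> // x Kx.
have : \forall y \near x, (~` K) y.
  apply: open_nbhs_nbhs; split=> //; apply: closed_openC.
  by apply: compact_closed cK; exact: Rhausdorff.
move=> nK; apply: is_derive1_fun.
have D0 : is_derive x 1 (cst (0:R)) 0 := is_derive_cst _ _ _.
apply: near_eq_is_derive D0.
by near=> y; rewrite K0//; near: y.
Unshelve. all: by end_near. Qed.

Lemma Rintegral_by_parts_test F f phi :
  (forall x, is_derive x 1 F (f x)) -> continuous f -> test_function phi ->
  \int[mu]_(x in oitv) (F x * derive1 phi x) = - \int[mu]_(x in oitv) (f x * phi x).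
Proof.
move=> dF cf tphi; have sphi := test_smooth tphi.
have cF := is_derive_continuous dF.
have c1 : continuous (fun x => f x * phi x).
  by apply: continuousM_fun => //; exact: smooth_continuous.
have c2 : continuous (fun x => F x * derive1 phi x).
  by apply: continuousM_fun => //; exact/smooth_continuous/smooth_derive.
apply/eqP; rewrite -addr_eq0; apply/eqP; rewrite addrC.
rewrite -RintegralD; [|exact: measurable_oitv|exact: integrable_oitv|exact: integrable_oitv].
have D x := is_derive_mul_fun (dF x) (smooth_is_derive sphi x).
rewrite (Rintegral_oitv_ftc D); last exact: continuousD_fun.
(* The endpoints lie outside the open interval, so the boundary terms vanish. *)
by rewrite !(test_function_out tphi) ?mulr0 ?subrr// oitvE ltxx ?andbF.
Qed.

(* Test with a combination of three bumps whose second primitive is compactly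
   supported, then shrink the bumps. *)
Lemma second_difference0 u : continuous u ->
  (forall phi, test_function phi ->
    \int[mu]_(x in oitv) (u x * derive1 (derive1 phi) x) = 0) ->
  forall y1 y2 y3, - h < y1 -> y1 < y2 -> y2 < y3 -> y3 < h ->
  (y3 - y2) * u y1 - (y3 - y1) * u y2 + (y2 - y1) * u y3 = 0.
Proof.
move=> cu Hu y1 y2 y3 hy1 y12 y23 y3h.
set S := (X in X = 0).
(* The sum of the absolute values of the three weights: an error [e] at each node costs at most
   [C * e = e'] in total. *)
set C := 2 * (y3 - y1).
have C0 : 0 < C by rewrite /C; lra.
apply/eqP; rewrite -normr_le0; apply/ler_addgt0Pr => e' e'0; rewrite add0r.
pose e := e' / C; have e0 : 0 < e by exact: divr_gt0.
have cvgu y : \forall d \near 0^'+, forall x, `|x - y| < d -> `|u x - u y| <= e.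
  have /cvgr_dist_le /(_ e e0) := cu y.
  move=> /nbhs_ballP[d /= d0 H]; near=> d' => x xd.
  rewrite distrC; apply: H; rewrite /ball /= distrC (lt_le_trans xd)//.
  by near: d'; exact: nbhs_right_le.
have [d [d0 dh1 dh3 [u1 u2 u3]]] : exists d : R, [/\ 0 < d, - h < y1 - d, y3 + d < h &
    [/\ forall x, `|x - y1| < d -> `|u x - u y1| <= e,
     forall x, `|x - y2| < d -> `|u x - u y2| <= e &
     forall x, `|x - y3| < d -> `|u x - u y3| <= e]].
  near (0:R)^'+ => d; exists d; split.
  - by near: d; exact: nbhs_right_gt.
  - have : d < y1 + h by near: d; apply: nbhs_right_lt; lra.
    lra.
  - have : d < h - y3 by near: d; apply: nbhs_right_lt; lra.
    lra.
  - by split; near: d; exact: cvgu.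
have [eta [E [EE [I [c [[s_eta sE sEE] [dEE dE] [I0 eta0] eta_out [Eleft Eright]]]]]]] :=
  bump_primitives d0.
have cshift (k : R) f y : smooth f -> smooth (fun x => k * f (1 * x + - y)).
  by move=> sf; apply: (smooth_mul (@smooth_cst R k)); exact: smooth_affine.
have dshift (k : R) (f g : R -> R) y : (forall x, is_derive x 1 f (g x)) ->
    forall x, is_derive x 1 (fun z => k * f (1 * z + - y)) (k * g (1 * x + - y)).
  move=> dfg x.
  have D := is_derive_comp_fun (g := fun z => 1 * z + - y) (dfg (1 * x + - y))
    (is_derive_affine 1 (- y) x).
  apply: is_derive_eq (is_derive_mul_fun (is_derive_cst k x 1) D) _.
  by rewrite /cst mul0r add0r mulr1.
(* The weights are those of the second difference at [y1], [y2], [y3]: their sum is zero, and so is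
   their sum against the nodes. *)
pose comb (f : R -> R) x := (y3 - y2) * f (1 * x + - y1) + (- (y3 - y1)) * f (1 * x + - y2)
  + (y2 - y1) * f (1 * x + - y3).
have dcomb f g : (forall x, is_derive x 1 f (g x)) ->
    forall x, is_derive x 1 (comb f) (comb g x).
  by move=> dfg x; do !apply: is_derive_sum_fun; exact: dshift.
have tphi : test_function (comb EE).
  split.
    exact: smooth_add (smooth_add (cshift _ _ _ sEE) (cshift _ _ _ sEE)) (cshift _ _ _ sEE).
  exists [set` `[y1 - d, y3 + d]]; split; first exact: segment_compact.
    move=> x /=; rewrite in_itv/= => /andP[? ?]; rewrite oitvE; apply/andP; split; lra.
  move=> x /=; rewrite in_itv/= => /negP; rewrite negb_and -!ltNge => /orP[xl|xr].
    by rewrite /comb !(Eleft _ _).2; [ring|lra|lra|lra].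
  by rewrite /comb !(Eright _ _).2; [ring|lra|lra|lra].
have := Hu _ tphi.
have -> : derive1 (derive1 (comb EE)) = comb eta.
  have -> : derive1 (comb EE) = comb E.
    by apply/funext => x; apply: is_derive1_fun; exact: dcomb.
  by apply/funext => x; apply: is_derive1_fun; exact: dcomb.
have c_eta y : continuous (fun x => eta (1 * x + - y)).
  by apply: smooth_continuous; exact: smooth_affine.
have cu_eta y : continuous (fun x => u x * eta (1 * x + - y)) by exact: continuousM_fun.
pose J y := \int[mu]_(x in oitv) (u x * eta (1 * x + - y)).
have -> : \int[mu]_(x in oitv) (u x * comb eta x) =
   (y3 - y2) * J y1 + (- (y3 - y1)) * J y2 + (y2 - y1) * J y3.
  have cZ (k : R) y : continuous (fun x => k * (u x * eta (1 * x + - y))).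
    by apply: continuousM_fun => //; exact: cst_continuous.
  rewrite /J -!(RintegralZl _ measurable_oitv (integrable_oitv _))//.
  rewrite -!(RintegralD measurable_oitv (integrable_oitv _) (integrable_oitv _))//.
    by apply: eq_Rintegral => x _; rewrite /comb; ring.
  exact: continuousD_fun.
(* A translate of [eta] has mass [I] and is concentrated within [d] of [y], so [J y / I] is a
   weighted mean of nearby values of [u]. *)
have JE y : y1 <= y -> y <= y3 -> (forall x, `|x - y| < d -> `|u x - u y| <= e) ->
    `|J y - u y * I| <= e * I.
  move=> y1y yy3 uy.
  have IE : I = \int[mu]_(x in oitv) eta (1 * x + - y).
    have D x : is_derive x 1 (fun z => 1 * E (1 * z + - y)) (eta (1 * x + - y)).
      by apply: is_derive_eq (dshift 1 _ _ y dE x) _; rewrite mul1r.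
    rewrite (Rintegral_oitv_ftc D)//.
    rewrite (Eright (1 * h + - y) _).1; last by lra.
    by rewrite (Eleft (1 * - h + - y) _).1; lra.
  rewrite [in X in X <= _]IE [in X in _ <= X]IE.
  rewrite -!(RintegralZl _ measurable_oitv (integrable_oitv _))//.
  have cZ (k : R) : continuous (fun x => k * eta (1 * x + - y)).
    by apply: continuousM_fun => //; exact: cst_continuous.
  rewrite /J -(RintegralB measurable_oitv (integrable_oitv _) (integrable_oitv _))//.
  have cB : continuous (fun x => u x * eta (1 * x + - y) - u y * eta (1 * x + - y)).
    by move=> x; apply: cvgB; [exact: cu_eta|exact: cZ].
  apply: le_trans (le_normr_Rintegral measurable_oitv (integrable_oitv cB)) _.
  apply: (le_Rintegral measurable_oitv).
  - apply: (@integrable_oitv (fun x => `|u x * eta (1 * x + - y) - u y * eta (1 * x + - y)|)).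
    by move=> x; apply: cvg_norm; exact: cB.
  - exact: integrable_oitv.
  - move=> x _; rewrite -mulrBl normrM (ger0_norm (eta0 _)).
    have [xd|xd] := ltP `|x - y| d; first by rewrite ler_wpM2r// uy.
    by rewrite eta_out ?mulr0// mul1r.
have := JE y1 (lexx _) (ltW (lt_trans y12 y23)) u1.
have := JE y2 (ltW y12) (ltW y23) u2.
have := JE y3 (ltW (lt_trans y12 y23)) (lexx _) u3.
move: (J y1) (J y2) (J y3) => J1 J2 J3 H3 H2 H1 HJ.
(* The weighted sum of the [J] terms is zero by [HJ], so [S] consists only of the three
   approximation errors. *)
have -> : S = (y3 - y2) * - ((J1 - u y1 * I) / I) + (y3 - y1) * ((J2 - u y2 * I) / I)
   + (y2 - y1) * - ((J3 - u y3 * I) / I).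
  have In0 : I != 0 by rewrite gt_eqF.
  rewrite /S; move: HJ; set v1 := u y1; set v2 := u y2; set v3 := u y3 => HJ.
  transitivity ((y3 - y2) * v1 - (y3 - y1) * v2 + (y2 - y1) * v3
    - ((y3 - y2) * J1 + - (y3 - y1) * J2 + (y2 - y1) * J3) / I).
    by rewrite HJ mul0r subr0.
  by field.
have bnd K y : `|K - u y * I| <= e * I -> `|(K - u y * I) / I| <= e.
  by move=> H; rewrite normrM normfV (gtr0_norm I0) ler_pdivrMr.
have := bnd _ _ H1; have := bnd _ _ H2; have := bnd _ _ H3.
move: (_ / I) (_ / I) (_ / I) => t3 t2 t1 b3 b2 b1.
have Z p t : 0 <= p -> `|t| <= e -> `|p * t| <= p * e.
  by move=> p0 te; rewrite normrM (ger0_norm p0) ler_wpM2l.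
have -> : e' = (y3 - y2) * e + (y3 - y1) * e + (y2 - y1) * e.
  by rewrite /e /C; field; rewrite gt_eqF//; lra.
rewrite (le_trans (ler_normD _ _))// lerD//; last by rewrite Z ?normrN//; lra.
by rewrite (le_trans (ler_normD _ _))// lerD//; rewrite Z ?normrN//; lra.
Unshelve. all: by end_near. Qed.

End TestFunctions.

(** * Weak second derivatives of continuous functions *)

Section Regularity.
Context {R : realType}.
Implicit Types (u v U f g : R -> R) (x a b t : R).
Local Notation mu := (@lebesgue_measure R).
Local Notation h := (pi / 2 : R).

Lemma pihalf_gt0 : 0 < h.
Proof. by have := pi_gt0 R; lra. Qed.

(** With the outer nodes at the endpoints, a zero second difference places [(x, u x)] on the chord
    of [u]; [c1] is the slope of that chord. *)
Lemma second_difference_affine u : continuous u ->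
  (forall phi, test_function phi ->
    \int[mu]_(x in oitv) (u x * derive1 (derive1 phi) x) = 0) ->
  exists c0 c1, forall x, citv x -> u x = c0 + c1 * x.
Proof.
move=> cu Hu; have h0 := pihalf_gt0.
pose c1 := (u h - u (- h)) / (2 * h).
exists (u h - c1 * h), c1 => x; rewrite citvE le_eqVlt => /andP[/predU1P[<- _|hx]].
  by rewrite /c1; field; lra.
rewrite le_eqVlt => /predU1P[->|xh]; first by rewrite subrK.
(* The second difference is known to vanish only at nodes inside the open interval. The nodes are
   scaled by [t < 1], and continuity in [t] carries the identity to [t = 1]. *)
pose D t := (t * h - t * x) * u (t * - h) - (t * h - t * - h) * u (t * x)
  + (t * x - t * - h) * u (t * h).
have cM (y : R) : continuous (fun t => t * y).
  by apply: continuousM_fun => // ?; [exact: cvg_id|exact: cvg_cst].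
have cD : continuous D.
  have cMu y : continuous (fun t => u (t * y)).
    by move=> t; apply: continuous_comp; [exact: cM|exact: cu].
  move=> t; apply: cvgD; first apply: cvgB.
  - apply: cvgM; [apply: cvgB; exact: cM|exact: cMu].
  - apply: cvgM; [apply: cvgB; exact: cM|exact: cMu].
  - apply: cvgM; [apply: cvgB; exact: cM|exact: cMu].
have D1 : D 1 = 0.
  have H1 : D t @[t --> 1^'-] --> D 1 by exact/cvg_at_left_filter/cD.
  have H2 : D t @[t --> 1^'-] --> (0 : R).
    apply: cvg_near_cst; near=> t.
    have t0 : 0 < t by near: t; exact: nbhs_left_gt.
    have t1 : t < 1 by near: t; exact: nbhs_left_lt.
    rewrite /D; apply: (second_difference0 cu Hu); last first.
    - by rewrite gtr_pMl.
    - by rewrite ltr_pM2l.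
    - by rewrite ltr_pM2l.
    - by rewrite mulrN ltrN2 gtr_pMl.
  exact: cvg_unique H1 H2.
move: D1; rewrite /D /c1 !mul1r => D1.
apply: (@mulfI _ (2 * h)); first by lra.
transitivity ((h - x) * u (- h) + (x - - h) * u h); first by lra.
by field; lra.
Unshelve. all: by end_near. Qed.

(* [u - U] is affine for a second primitive [U] of [v]. *)
Lemma weak_second_derivative u v : continuous u -> continuous v ->
  (forall phi, test_function phi ->
    \int[mu]_(x in oitv) (u x * derive1 (derive1 phi) x) =
    \int[mu]_(x in oitv) (v x * phi x)) ->
  exists U U1, [/\ forall x, is_derive x 1 U (U1 x), forall x, is_derive x 1 U1 (v x) &
    forall x, citv x -> u x = U x].
Proof.
move=> cu cv Huv.
have [V1 dV1] := primitive cv; have cV1 := is_derive_continuous dV1.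
have [V dV] := primitive cV1; have cV := is_derive_continuous dV.
have [x|phi tphi|c0 [c1 Huc]] := @second_difference_affine (fun x => u x - V x).
- by apply: cvgB; [exact: cu|exact: cV].
- have t1 := test_function_derive tphi; have t2 := test_function_derive t1.
  have int f psi : continuous f -> test_function psi ->
      mu.-integrable oitv (EFin \o (fun x => f x * psi x)).
    move=> cf tpsi; apply: integrable_oitv.
    exact: continuousM_fun cf (smooth_continuous (test_smooth tpsi)).
  transitivity (\int[mu]_(x in oitv) (u x * derive1 (derive1 phi) x)
      - \int[mu]_(x in oitv) (V x * derive1 (derive1 phi) x)).
    rewrite -(RintegralB measurable_oitv (int _ _ cu t2) (int _ _ cV t2)).
    by apply: eq_Rintegral => x _; rewrite mulrBl.
  rewrite (Rintegral_by_parts_test dV cV1 t1) (Rintegral_by_parts_test dV1 cv tphi).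
  by rewrite Huv// opprK subrr.
exists (fun x => V x + (c1 * x + c0)), (fun x => V1 x + c1); split=> x.
- exact: is_derive_sum_fun (dV x) (is_derive_affine c1 c0 x).
- apply: is_derive_eq (is_derive_sum_fun (dV1 x) (is_derive_cst c1 x 1)) _.
  by rewrite addr0.
- by move=> /Huc H; rewrite [c1 * x + _]addrC -H addrC subrK.
Qed.

(** The retraction of the line onto [citv], in a form whose continuity is immediate. Composing with
    it extends a function continuous on [citv] to the whole line, where primitives are available. *)
Definition clamp x : R := (`|x + h| - `|x - h|) / 2.

Lemma clamp_id x : citv x -> clamp x = x.
Proof.
rewrite citvE => /andP[hx xh]; rewrite /clamp ger0_norm; last by lra.
by rewrite ler0_norm; lra.
Qed.

Lemma clamp_citv x : citv (clamp x).
Proof.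
have h0 := pihalf_gt0.
rewrite citvE /clamp; case: (ler0P (x + h)); case: (ler0P (x - h)); lra.
Qed.

Lemma clamp_continuous : continuous clamp.
Proof.
move=> x; apply: cvgM; last exact: cvg_cst.
apply: cvgB; apply: cvg_norm.
  by apply: cvgD; [exact: cvg_id|exact: cvg_cst].
by apply: cvgB; [exact: cvg_id|exact: cvg_cst].
Qed.

Lemma continuous_clamp (T : topologicalType) (f : R -> T) :
  {within citv, continuous f} -> continuous (fun x => f (clamp x)).
Proof.
move=> /subspace_continuousP cf x.
apply: (cvg_comp clamp f _ (cf _ (clamp_citv x))).
move=> A; rewrite /within /= => nA.
have nA' : \forall y \near x, citv (clamp y) -> A (clamp y) := clamp_continuous nA.
change (\forall y \near x, A (clamp y)).
by apply: filterS nA' => y; apply; exact: clamp_citv.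
Qed.

End Regularity.

(** * Complex-valued functions of a real variable *)

Section ComplexCalculus.
Context {R : realType}.
Implicit Types (f g F G psi : R -> R[i]) (x y a : R) (lambda k z w : R[i]).
Local Notation mu := (@lebesgue_measure R).
Local Notation h := (pi / 2 : R).
Local Notation Re := (@complex.Re R).
Local Notation Im := (@complex.Im R).

Lemma ReD z w : Re (z + w) = Re z + Re w. Proof. by case: z; case: w. Qed.
Lemma ImD z w : Im (z + w) = Im z + Im w. Proof. by case: z; case: w. Qed.
Lemma ReN z : Re (- z) = - Re z. Proof. by case: z. Qed.
Lemma ImN z : Im (- z) = - Im z. Proof. by case: z. Qed.
Lemma ReM z w : Re (z * w) = Re z * Re w - Im z * Im w.
Proof. by case: z; case: w. Qed.
Lemma ImM z w : Im (z * w) = Re z * Im w + Im z * Re w.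
Proof. by case: z; case: w. Qed.
Lemma complexP z w : Re z = Re w -> Im z = Im w -> z = w.
Proof. by case: z => ? ?; case: w => ? ? /= -> ->. Qed.

Definition cderiv f x z : Prop :=
  is_derive x 1 (fun t => Re (f t)) (Re z) /\ is_derive x 1 (fun t => Im (f t)) (Im z).

Definition ccontinuous f : Prop :=
  continuous (fun t => Re (f t)) /\ continuous (fun t => Im (f t)).

Lemma cderiv_continuous f g : (forall x, cderiv f x (g x)) -> ccontinuous f.
Proof.
by move=> fg; split; apply: is_derive_continuous => x; [exact: (fg x).1|exact: (fg x).2].
Qed.

Lemma cderiv_cst z x : cderiv (fun=> z) x 0.
Proof. by split; exact: is_derive_cst. Qed.

Lemma cderivD f g x z w : cderiv f x z -> cderiv g x w ->
  cderiv (fun t => f t + g t) x (z + w).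
Proof.
move=> [f1 f2] [g1 g2]; split.
  under [X in is_derive _ _ X]funext do rewrite ReD.
  rewrite ReD; exact: is_derive_sum_fun.
under [X in is_derive _ _ X]funext do rewrite ImD.
rewrite ImD; exact: is_derive_sum_fun.
Qed.

Lemma cderivM f g x z w : cderiv f x z -> cderiv g x w ->
  cderiv (fun t => f t * g t) x (z * g x + f x * w).
Proof.
move=> [f1 f2] [g1 g2]; split.
  under [X in is_derive _ _ X]funext do rewrite ReM.
  apply: is_derive_eq (is_deriveB (is_derive_mul_fun f1 g1) (is_derive_mul_fun f2 g2)) _.
  by rewrite ReD !ReM; ring.
under [X in is_derive _ _ X]funext do rewrite ImM.
apply: is_derive_eq (is_derive_sum_fun (is_derive_mul_fun f1 g2) (is_derive_mul_fun f2 g1)) _.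
by rewrite ImD !ImM; ring.
Qed.

Lemma cderivZ z f x w : cderiv f x w -> cderiv (fun t => z * f t) x (z * w).
Proof.
by move=> fw; have := cderivM (cderiv_cst z x) fw; rewrite mul0r add0r.
Qed.

Lemma cderiv_real (f : R -> R) x (d : R) : is_derive x 1 f d ->
  cderiv (fun t => (f t)%:C) x d%:C.
Proof. by move=> fd; split=> //; exact: is_derive_cst. Qed.

Lemma cderiv0_citv f g : (forall x, cderiv f x (g x)) ->
  (forall x, citv x -> g x = 0) -> forall x, citv x -> f x = f (- h).
Proof.
move=> fg g0 x; rewrite citvE => /andP[hx xh].
have in0 t : t \in `]- h, x[ -> g t = 0.
  by rewrite in_itv /= => /andP[? ?]; apply: g0; rewrite citvE; apply/andP; split; lra.
symmetry; apply: complexP.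
  by apply: (is_derive0_itv hx (fun t => (fg t).1)) => t /in0 ->.
by apply: (is_derive0_itv hx (fun t => (fg t).2)) => t /in0 ->.
Qed.

(** This is [exp(ikx)] for complex [k], split into real and imaginary parts. *)
Definition cexpi k x : R[i] :=
  (expR (- Im k * x) * cos (Re k * x)) +i* (expR (- Im k * x) * sin (Re k * x)).

Lemma cderiv_cexpi k x : cderiv (cexpi k) x ('i * k * cexpi k x).
Proof.
have dl (c : R) : is_derive x 1 (fun t => c * t) c.
  apply: is_derive_eq (is_derive_mul_fun (is_derive_cst c x 1) (is_derive_id x 1)) _.
  by rewrite mul0r add0r mulr1.
have dE := is_derive_comp_fun (g := fun t => - Im k * t) (is_derive_expR _) (dl (- Im k)).
have dC := is_derive_comp_fun (g := fun t => Re k * t) (is_derive_cos _) (dl (Re k)).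
have dS := is_derive_comp_fun (g := fun t => Re k * t) (is_derive_sin _) (dl (Re k)).
split.
  apply: is_derive_eq (is_derive_mul_fun dE dC) _.
  by rewrite !ReM !ImM /=; ring.
apply: is_derive_eq (is_derive_mul_fun dE dS) _.
by rewrite !ImM !ReM /=; ring.
Qed.

Lemma cexpiD k x y : cexpi k (x + y) = cexpi k x * cexpi k y.
Proof.
apply: complexP; rewrite ?ReM ?ImM /= !mulrDr expRD ?cosD ?sinD; ring.
Qed.

Lemma cexpi0 k : cexpi k 0 = 1.
Proof. by rewrite /cexpi !mulr0 expR0 cos0 sin0 mulr1 mulr0. Qed.

Lemma cexpi_neq0 k x : cexpi k x != 0.
Proof.
apply/eqP => e0; have := cexpiD k x (- x).
by rewrite e0 mul0r subrr cexpi0 => /eqP; rewrite oner_eq0.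
Qed.

Lemma cexpiN k x : cexpi k (- x) = (cexpi k x)^-1.
Proof.
by apply: (mulfI (cexpi_neq0 k x)); rewrite -cexpiD subrr cexpi0 divff// cexpi_neq0.
Qed.

Lemma cexpiNk k x : cexpi (- k) x = cexpi k (- x).
Proof. by rewrite /cexpi ReN ImN !mulNr !mulrN opprK. Qed.

Lemma cintegral_mul_real f (phi : R -> R) :
  cintegral (fun x => f x * (phi x)%:C) =
  (\int[mu]_(x in oitv) (Re (f x) * phi x)) +i* (\int[mu]_(x in oitv) (Im (f x) * phi x)).
Proof.
congr (_ +i* _); apply: eq_Rintegral => x _.
  by rewrite ReM /= mulr0 subr0.
by rewrite ImM /= mulr0 add0r.
Qed.

Lemma Re_continuous : continuous (Re : R[i]^o -> R).
Proof.
move=> z; have FF : Filter (nbhs (z : R[i]^o)) by exact: nbhs_filter.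
apply/(@cvgrPdist_lt _ _ _ _ FF) => e e0; apply/nbhs_ballP; exists e%:C => /=.
  by rewrite ltcR.
move=> w; rewrite /ball /= => zw; rewrite -ReN -ReD -ltcR.
exact: le_lt_trans (normc_ge_Re _) zw.
Qed.

Lemma Im_continuous : continuous (Im : R[i]^o -> R).
Proof.
move=> z; have FF : Filter (nbhs (z : R[i]^o)) by exact: nbhs_filter.
apply/(@cvgrPdist_lt _ _ _ _ FF) => e e0; apply/nbhs_ballP; exists e%:C => /=.
  by rewrite ltcR.
move=> w; rewrite /ball /= => zw; rewrite -ImN -ImD -ltcR.
apply: le_lt_trans zw; rewrite normc_def lecR -sqrtr_sqr ler_wsqrtr//.
by rewrite lerDr sqr_ge0.
Qed.

Lemma real_complex_continuous : continuous ((fun x => x%:C) : R -> R[i]^o).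
Proof.
(* In the partial order of [R[i]] a positive radius [e] has zero imaginary part, so it is the real
   number [Re e]. *)
move=> x; apply/cvgrPdist_lt => e; rewrite ltcE /= => /andP[/eqP e1 e0].
near=> y; rewrite -raddfB /= normc_def /= expr0n addr0 sqrtr_sqr ltcE /= -e1 eqxx /=.
near: y; exact: (@nbhsx_ballx _ _ x (Re e) e0).
Unshelve. all: by end_near. Qed.

Lemma ccontinuousP f : ccontinuous f -> continuous (f : R -> R[i]^o).
Proof.
move=> [cR cI] x.
have -> : f = fun t => (Re (f t))%:C + 'i%C *: ((Im (f t))%:C : R[i]^o).
  by apply/funext => t; rewrite [LHS]complexE.
have cc (u : R -> R) : continuous u -> continuous ((fun t => (u t)%:C) : R -> R[i]^o).
  by move=> cu t; apply: continuous_comp; [exact: cu|exact: real_complex_continuous].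
apply: cvgD; first exact: (cc _ cR).
exact: (cvgZl_tmp (cc _ cI x)).
Qed.

End ComplexCalculus.

(** * The kernel as a space of classical solutions *)

Section Kernel.
Context {R : realType}.
Implicit Types (f g F G psi : R -> R[i]) (x y a : R) (lambda k z w A B : R[i]).
Local Notation mu := (@lebesgue_measure R).
Local Notation h := (pi / 2 : R).
Local Notation Re := (@complex.Re R).
Local Notation Im := (@complex.Im R).

Lemma weak_deriv2_test psi f phi : weak_deriv2 psi f -> test_function phi ->
  cintegral (fun x => psi x * (derive1 (derive1 phi) x)%:C) =
  cintegral (fun x => f x * (phi x)%:C).
Proof.
move=> [g [_ pg gf]] tphi.
by rewrite (pg _ (test_function_derive tphi)) gf// opprK.
Qed.

(** The right-hand side keeps [clamp] because [F] and [G] live on the whole line; on [citv] it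
    disappears and the equation becomes [F'' = - lambda F]. *)
Lemma kerH_classical a lambda psi : kerH a lambda psi ->
  exists F G, [/\ forall x, cderiv F x (G x),
    forall x, cderiv G x (- (lambda * psi (clamp x))) &
    forall x, citv x -> psi x = F x].
Proof.
move=> [[_ [cpsi _] _ _] _ wpsi].
have cc : continuous ((fun x => psi (clamp x)) : R -> R[i]^o) by exact: continuous_clamp.
pose p x := Re (psi (clamp x)); pose q x := Im (psi (clamp x)).
have cp : continuous p.
  move=> x; apply: (@continuous_comp _ _ _ ((fun x => psi (clamp x)) : R -> R[i]^o)
    (Re : R[i]^o -> R)); [exact: cc|exact: Re_continuous].
have cq : continuous q.
  move=> x; apply: (@continuous_comp _ _ _ ((fun x => psi (clamp x)) : R -> R[i]^o)
    (Im : R[i]^o -> R)); [exact: cc|exact: Im_continuous].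
have cZ (c : R) (u : R -> R) : continuous u -> continuous (fun x => c * u x).
  by move=> cu; apply: continuousM_fun => //; exact: cst_continuous.
(* [v1] and [v2] are the real and imaginary parts of [- lambda psi]; a non-real [lambda] couples [p]
   and [q]. *)
pose v1 x := - Re lambda * p x + Im lambda * q x.
pose v2 x := - Re lambda * q x + - Im lambda * p x.
have cv1 : continuous v1 by apply: continuousD_fun; exact: cZ.
have cv2 : continuous v2 by apply: continuousD_fun; exact: cZ.
have Hphi phi : test_function phi ->
    \int[mu]_(x in oitv) (p x * derive1 (derive1 phi) x) =
    \int[mu]_(x in oitv) (v1 x * phi x) /\
    \int[mu]_(x in oitv) (q x * derive1 (derive1 phi) x) =
    \int[mu]_(x in oitv) (v2 x * phi x).
  move=> tphi; have := weak_deriv2_test wpsi tphi.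
  rewrite !cintegral_mul_real => -[E1 E2]; split.
    transitivity (\int[mu]_(x in oitv) (Re (psi x) * derive1 (derive1 phi) x)).
      by apply: eq_Rintegral => x /set_mem/oitv_citv xc; rewrite /p clamp_id.
    rewrite E1; apply: eq_Rintegral => x /set_mem/oitv_citv xc.
    by rewrite /v1 /p /q clamp_id// ReN ReM; congr (_ * _); ring.
  transitivity (\int[mu]_(x in oitv) (Im (psi x) * derive1 (derive1 phi) x)).
    by apply: eq_Rintegral => x /set_mem/oitv_citv xc; rewrite /q clamp_id.
  rewrite E2; apply: eq_Rintegral => x /set_mem/oitv_citv xc.
  by rewrite /v2 /p /q clamp_id// ImN ImM; congr (_ * _); ring.
have [U [U1 [dU dU1 pU]]] := weak_second_derivative cp cv1 (fun phi t => (Hphi phi t).1).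
have [V [V1 [dV dV1 qV]]] := weak_second_derivative cq cv2 (fun phi t => (Hphi phi t).2).
exists (fun x => U x +i* V x), (fun x => U1 x +i* V1 x); split=> x.
- by split; [exact: dU|exact: dV].
- split; rewrite ?ReN ?ImN ?ReM ?ImM.
    by apply: is_derive_eq (dU1 x) _; rewrite /v1 /p /q; ring.
  by apply: is_derive_eq (dV1 x) _; rewrite /v2 /p /q; ring.
- move=> xc; apply: complexP => /=.
    by rewrite -pU// /p clamp_id.
  by rewrite -qV// /q clamp_id.
Qed.

(* [psi' -+ i k psi] solve first-order equations, hence are exponentials. *)
Lemma kerH_exponential a k psi : k != 0 -> kerH a (k ^+ 2) psi ->
  exists A B, forall x, citv x -> psi x = A * cexpi k x + B * cexpi k (- x).
Proof.
move=> k0 /kerH_classical[F [G [dF dG psiF]]].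
have i2 : 'i * 'i = -1 :> R[i] by rewrite -expr2 sqr_i.
(* [exp(iwx)] is an integrating factor for [G - i w F]; taking [w = k] and [w = -k] gives two first
   integrals. *)
have const w : w ^+ 2 = k ^+ 2 -> forall x, citv x ->
    (G x + - ('i * w) * F x) * cexpi w x = (G (- h) + - ('i * w) * F (- h)) * cexpi w (- h).
  move=> wk x xc.
  have D y := cderivM (cderivD (dG y) (cderivZ (- ('i * w)) (dF y))) (cderiv_cexpi w y).
  apply: (cderiv0_citv D) xc => y yc.
  rewrite clamp_id// psiF//.
  transitivity (- (k ^+ 2 + ('i * 'i) * w ^+ 2) * F y * cexpi w y); first by ring.
  by rewrite i2 wk; ring.
have C1 := const k erefl.
have C2 := const (- k) (sqrrN k).
set c1 := (X in forall x, _ -> _ = X) in C1.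
set c2 := (X in forall x, _ -> _ = X) in C2.
(* Eliminating [G] between the two first integrals leaves [2 i k F = c2 exp(ikx) - c1 exp(-ikx)]. *)
exists (c2 / (2 * 'i * k)), (- c1 / (2 * 'i * k)) => x xc.
have i0 : 'i != 0 :> R[i] by rewrite eq_complex /= oner_eq0 andbF.
have e0 := cexpi_neq0 k x.
rewrite psiF// -(C1 x xc) -(C2 x xc) cexpiNk cexpiN.
by field; rewrite e0 i0 k0.
Qed.

Lemma kerH_affine a psi : kerH a 0 psi ->
  exists A B, forall x, citv x -> psi x = A + B * x%:C.
Proof.
move=> /kerH_classical[F [G [dF dG psiF]]].
have CG x : citv x -> G x = G (- h).
  by apply: (cderiv0_citv dG) => // y _; rewrite mul0r oppr0.
have CF x : citv x -> F x + - G (- h) * x%:C = F (- h) + - G (- h) * (- h)%:C.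
  have D y := cderivD (dF y) (cderivZ (- G (- h)) (cderiv_real (is_derive_id y 1))).
  apply: (cderiv0_citv D) => y yc.
  by rewrite CG// mulr1 subrr.
exists (F (- h) + - G (- h) * (- h)%:C), (G (- h)) => x xc.
by rewrite psiF// -(CF x xc) mulNr subrK.
Qed.

Lemma L2_eq_continuous f F : ccontinuous F -> (forall x, oitv x -> f x = F x) -> L2 f.
Proof.
move=> [cR cI] fF; split.
- apply: (eq_measurable_fun (fun x => Re (F x))).
    by move=> x /set_mem xo; rewrite fF.
  apply: measurable_funTS.
  exact: measurable_realfun.continuous_measurable_fun cR.
- apply: (eq_measurable_fun (fun x => Im (F x))).
    by move=> x /set_mem xo; rewrite fF.
  apply: measurable_funTS.
  exact: measurable_realfun.continuous_measurable_fun cI.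
- have c2 : continuous (fun x => Re (F x) ^+ 2 + Im (F x) ^+ 2).
    by apply: continuousD_fun; apply: continuousM_fun.
  under eq_integral => x /set_mem xo do rewrite fF//.
  have := integrable_lty measurable_oitv (integrable_oitv c2); exact.
Qed.

Lemma weak_deriv_cderiv f g F G : (forall x, cderiv F x (G x)) -> ccontinuous G ->
  (forall x, oitv x -> f x = F x) -> (forall x, oitv x -> g x = G x) -> weak_deriv f g.
Proof.
move=> dF [cG1 cG2] fF gG phi tphi.
rewrite !cintegral_mul_real; apply: complexP; rewrite ?ReN ?ImN /=.
  transitivity (\int[mu]_(x in oitv) (Re (F x) * derive1 phi x)).
    by apply: eq_Rintegral => x /set_mem xo; rewrite fF.
  rewrite (Rintegral_by_parts_test (fun x => (dF x).1) cG1 tphi); congr (- _).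
  by apply: eq_Rintegral => x /set_mem xo; rewrite gG.
transitivity (\int[mu]_(x in oitv) (Im (F x) * derive1 phi x)).
  by apply: eq_Rintegral => x /set_mem xo; rewrite fF.
rewrite (Rintegral_by_parts_test (fun x => (dF x).2) cG2 tphi); congr (- _).
by apply: eq_Rintegral => x /set_mem xo; rewrite gG.
Qed.

Lemma patch_citv F x : citv x -> patch (fun=> 0) citv F x = F x.
Proof. by move=> xc; rewrite patchT// inE. Qed.

Lemma citv_bounds a : -1 < a < 1 -> [/\ citv (- h), citv (h * a) & citv h].
Proof.
move=> /andP[a1 a2]; have h0 := @pihalf_gt0 R.
split; rewrite citvE; apply/andP; split; rewrite ?lexx//; try lra.
  by rewrite -mulrN1 ler_pM2l// ltW.
by rewrite ler_piMr// ltW.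
Qed.

(** The converse passage from classical to weak solutions. Extension by zero may create jumps at the
    endpoints, but integrals and weak derivatives see only [oitv], and continuity is required only
    within [citv]. *)
Lemma classical_kerH a lambda F G : -1 < a < 1 ->
  (forall x, cderiv F x (G x)) -> (forall x, cderiv G x (- (lambda * F x))) ->
  F (- h) = F (h * a) -> F (h * a) = F h ->
  kerH a lambda (patch (fun=> 0) citv F).
Proof.
move=> ha dF dG b1 b2; have [c1 c2 c3] := citv_bounds ha.
set psi := patch _ _ _.
have psiE x : oitv x -> psi x = F x by move=> /oitv_citv; exact: patch_citv.
have cF := cderiv_continuous dF; have cG := cderiv_continuous dG.
have cN : ccontinuous (fun x => - lambda * F x).
  by apply: cderiv_continuous => x; exact: cderivZ (dF x).
have cP : ccontinuous (fun x => lambda * F x).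
  by apply: cderiv_continuous => x; exact: cderivZ (dF x).
have w2 : weak_deriv2 psi (- (lambda *: psi)).
  exists G; split.
  - exact: (L2_eq_continuous cG).
  - exact: (weak_deriv_cderiv dF cG).
  - apply: (weak_deriv_cderiv dG _ (fun _ _ => erefl)).
      by under eq_fun do rewrite -mulNr.
    by move=> x xo; rewrite -psiE.
split=> //; last first.
  by apply: (L2_eq_continuous cP) => x xo; rewrite -psiE.
split.
- split; first exact: (L2_eq_continuous cF).
  exists (- (lambda *: psi)) => //.
  by apply: (L2_eq_continuous cN) => x xo; rewrite mulNr -psiE.
- split; last by move=> x xc; rewrite /psi patchN// notin_setE.
  apply/subspace_continuousP => x xc.
  change (psi y @[y --> within citv (nbhs x)] --> (psi x : R[i]^o)).
  have -> : psi x = F x by exact: patch_citv.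
  have cFx : F y @[y --> within citv (nbhs x)] --> (F x : R[i]^o).
    by apply: cvg_within_filter; exact: (ccontinuousP cF).
  apply: cvg_trans cFx; apply: near_eq_cvg; near=> y.
  have yc : citv y by near: y; exact: withinT.
  by rewrite /psi patch_citv.
- by rewrite /psi !patch_citv.
- by rewrite /psi !patch_citv.
Unshelve. all: by end_near. Qed.

End Kernel.

(** * Boundary conditions *)

Section BoundaryConditions.
Context {R : realType}.
Implicit Types (psi : R -> R[i]) (phi : R -> R) (x a k : R) (lambda z A B : R[i]).
Local Notation h := (pi / 2 : R).
Local Notation Re := (@complex.Re R).
Local Notation Im := (@complex.Im R).

(** Removing the largest multiple of [pi] below [x] changes the sine by a sign only; a nonzero
    remainder would lie in []0, pi[], where the sine is positive. *)
Lemma sin_eq0_nat x : 0 < x -> sin x = 0 -> exists2 m : nat, (0 < m)%N & x = m%:R * pi.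
Proof.
move=> x0 sx; have pi0 := pi_gt0 R.
pose m := Num.truncn (x / pi).
have /andP[m1 m2] : m%:R <= x / pi < m.+1%:R by apply: truncn_itv; rewrite divr_ge0// ltW.
rewrite ler_pdivlMr// in m1; rewrite ltr_pdivrMr// -natr1 in m2.
have xE : x = m%:R * pi.
  apply: contra_eq sx => xm.
  have -> : x = (x - m%:R * pi) + pi *+ m by rewrite -[pi *+ m]mulr_natl subrK.
  rewrite (alternatingn (@sinDpi R)) mulf_neq0 ?signr_eq0// gt_eqF//.
  apply: sin_gt0_pi; apply/andP; split; last by lra.
  by rewrite subr_gt0 lt_neqAle m1 eq_sym xm.
by exists m => //; rewrite lt0n; apply: contraTneq x0 => m0; rewrite xE m0 mul0r ltxx.
Qed.

Lemma sin_natpi (m : nat) : sin (m%:R * pi : R) = 0.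
Proof.
by rewrite -[_ * pi]add0r mulr_natl (alternatingn (@sinDpi R)) sin0 mulr0.
Qed.

(** This excludes non-real frequencies: the modulus [exp(- x Im z)] equals one, so [Im z = 0]. *)
Lemma cexpi_eq1 z x : 0 < x -> z != 0 -> cexpi z x = 1 ->
  exists2 m : nat, (0 < m)%N & z ^+ 2 = ((2 * m%:R * pi / x) ^+ 2)%:C.
Proof.
move=> x0 z0 [Ec Es].
have E0 := expR_gt0 (- Im z * x).
have s0 : sin (Re z * x) = 0.
  by move/eqP: Es; rewrite mulf_eq0 gt_eqF// => /eqP.
have c0 : 0 < cos (Re z * x) by rewrite -(pmulr_rgt0 _ E0) Ec.
have c1 : cos (Re z * x) = 1.
  by have := sin0cos1 s0; rewrite gtr0_norm.
have Im0 : Im z = 0.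
  move: Ec; rewrite c1 mulr1 -[RHS]expR0 => /expR_inj/eqP.
  by rewrite mulf_eq0 oppr_eq0 (gt_eqF x0) orbF => /eqP.
have Re0 : Re z != 0.
  by apply: contraNneq z0 => r0; apply/eqP/complexP.
(* With the half angle, [cos (2 t) = 1] means [sin t = 0], so [Re z * x] is, up to sign, an even
   multiple of [pi]. *)
pose t := `|Re z * x| / 2.
have t0 : 0 < t by rewrite divr_gt0// normr_gt0 mulf_neq0// gt_eqF.
have ct : cos (t *+ 2) = 1.
  rewrite -[t *+ 2]mulr_natr divfK ?pnatr_eq0//.
  by case: (ler0P (Re z * x)) => _; rewrite ?cosN.
have [|m m0 tm] := sin_eq0_nat t0.
  apply/eqP; rewrite -sqrf_eq0; apply/eqP; have := cos2Dsin2 t.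
  by move: ct; rewrite cos_mulr2n; lra.
exists m => //.
have -> : z = (Re z)%:C by apply: complexP.
rewrite -rmorphXn /=; congr (_%:C).
have -> : 2 * m%:R * pi = `|Re z * x| by rewrite -mulrA -tm /t; lra.
by rewrite expr_div_n real_normK ?num_real// exprMn mulfK// sqrf_eq0 gt_eqF.
Qed.

Lemma on_citvE phi x : citv x -> on_citv phi x = (phi x)%:C.
Proof. exact: patch_citv. Qed.

Lemma on_citv_out phi x : ~ citv x -> on_citv phi x = 0.
Proof. by move=> xc; rewrite /on_citv patchN// notin_setE. Qed.

Lemma citv0 : citv (0 : R).
Proof. by rewrite citvE; have := @pihalf_gt0 R; lra. Qed.

Lemma on_citv_neq0 phi x : citv x -> phi x != 0 -> on_citv phi <> 0.
Proof.
move=> xc p0 /(congr1 (fun f => f x)); rewrite on_citvE// => -[] /eqP.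
by rewrite (negbTE p0).
Qed.

Lemma scaled_on_citv z phi x : (z *: on_citv phi) x = z * on_citv phi x.
Proof. by []. Qed.

Lemma one_dimensional_kernel a lambda phi x : citv x -> phi x != 0 ->
  (forall psi, kerH a lambda psi <-> exists c : R[i], psi = c *: on_citv phi) ->
  unique_eigenfunction a lambda phi /\ geom_mult a lambda 1.
Proof.
move=> xc px ker; have phi0 := on_citv_neq0 xc px.
have scal0 (c : R[i]) : c *: on_citv phi = 0 -> c = 0.
  move=> /eqP; rewrite scaler_eq0 => /orP[/eqP//|/eqP e0].
  by case: (phi0 e0).
split.
  move=> psi; split.
    move=> [/ker[c ->] c0]; exists c => //.
    by apply/eqP => c0'; apply: c0; rewrite c0' scale0r.
  move=> [c c0 ->]; split; first by apply/ker; exists c.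
  by move=> /scal0/eqP; rewrite (negbTE c0).
exists [:: on_citv phi]; split=> //.
  move=> c; rewrite /lin_comb big_ord1 /= => /scal0 H i.
  by rewrite (_ : i = ord0) //; apply/val_inj; case: i => -[].
apply/seteqP; split=> psi.
  move=> /ker[c ->]; exists (fun=> c) => //.
  by rewrite /lin_comb big_ord1.
by move=> [c _ <-]; apply/ker; exists (c ord0); rewrite /lin_comb big_ord1.
Qed.

(** * The boundary conditions for [k > 0] as a linear system in [A] and [B] *)

Section PositiveEigenvalue.
Variables (a k : R).
Hypotheses (ha : -1 < a < 1) (k0 : 0 < k).
(* The phases at [pi / 2] and [a * pi / 2] are [u + v] and [u - v]; the
   conditions [sin v = 0], [sin u = 0], [sin (u + v) = 0] say that [k ^ 2] lies
   in [sigma_m1], [sigma_p1], [sigma_0]. *)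
Local Notation u := (k * pi * (1 + a) / 4).
Local Notation v := (k * pi * (1 - a) / 4).
Local Notation C := (on_citv (fun x => cos (k * x))).
Local Notation S := (on_citv (fun x => sin (k * x))).

Lemma kh_E : k * h = u + v.
Proof. by lra. Qed.

Lemma kha_E : k * (h * a) = u - v.
Proof. by lra. Qed.

Lemma cexpi_real x : cexpi k%:C x = (cos (k * x))%:C + 'i * (sin (k * x))%:C.
Proof. by apply: complexP; rewrite ?ReD ?ImD ?ReM ?ImM /= oppr0 !mul0r expR0; ring. Qed.

Lemma trig_combination_eq psi A B : (forall x, ~ citv x -> psi x = 0) ->
  (forall x, citv x -> psi x = A * (cos (k * x))%:C + B * (sin (k * x))%:C) ->
  psi = A *: C + B *: S.
Proof.
move=> out inn; apply/funext => x.
have [xc|xc] := pselect (citv x); first by rewrite inn// !fctE !on_citvE.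
by rewrite out// !fctE !on_citv_out// /GRing.scale /= !mulr0 addr0.
Qed.

(** Equal values at [-h] and [h] say that the odd part vanishes at [h], which is the first equation.
    The second is the condition at [h * a] with the term [B sin(u + v)] dropped. *)
Lemma kerH_trig psi : kerH a (k ^+ 2)%:C psi <->
  exists A B, [/\ psi = A *: C + B *: S, B * (sin (u + v))%:C = 0 &
    A * (cos (u + v) - cos (u - v))%:C = B * (sin (u - v))%:C].
Proof.
have [c1 c2 c3] := citv_bounds ha.
split.
  move=> kp; have [[_ [_ out] b1 b2] _ _] := kp.
  have kC0 : k%:C != 0 :> R[i] by rewrite eq_complex /= gt_eqF.
  rewrite rmorphXn /= in kp.
  have [A [B psiE]] := kerH_exponential kC0 kp.
  have psiE' x : citv x -> psi x = (A + B) * (cos (k * x))%:C + ('i * (A - B)) * (sin (k * x))%:C.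
    move=> xc; rewrite psiE// !cexpi_real mulrN cosN sinN.
    apply: complexP; rewrite ?ReD ?ImD ?ReM ?ImM /= ?ReD ?ImD ?ReM ?ImM /=.
      by rewrite ?ReD ?ImD ?ReM ?ImM ?ReN ?ImN /=; ring.
    by rewrite ?ReD ?ImD ?ReM ?ImM ?ReN ?ImN /=; ring.
  move: (A + B) ('i * (A - B)) psiE' => {A B psiE} A B psiE.
  move: b1 b2; rewrite !psiE// mulrN cosN sinN kh_E kha_E => b1 b2.
  have Bs : B * (sin (u + v))%:C = 0.
    move: b1; rewrite b2 rmorphN /= => b1.
    apply: (@mulfI _ 2); first by rewrite pnatr_eq0.
    rewrite mulr0 -[RHS](subrr (A * (cos (u + v))%:C + B * (sin (u + v))%:C)).
    by rewrite -[X in _ = _ - X]b1 ; ring.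
  exists A, B; split=> //; first exact: trig_combination_eq.
  by rewrite rmorphB /= mulrBr; move: b2; rewrite Bs addr0 => <-; ring.
move=> [A [B [-> Bs AB]]].
pose F x := A * (cos (k * x))%:C + B * (sin (k * x))%:C.
pose G x := A * (- (k * sin (k * x)))%:C + B * (k * cos (k * x))%:C.
have <- : patch (fun=> 0) citv F = A *: C + B *: S.
  apply: trig_combination_eq => x xc; last exact: patch_citv.
  by rewrite patchN// notin_setE.
have dl x : is_derive x 1 (fun t => k * t) k.
  apply: is_derive_eq (is_derive_mul_fun (is_derive_cst k x 1) (is_derive_id x 1)) _.
  by rewrite mul0r add0r mulr1.
have dC x := is_derive_comp_fun (g := fun t => k * t) (is_derive_cos _) (dl x).
have dS x := is_derive_comp_fun (g := fun t => k * t) (is_derive_sin _) (dl x).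
apply: (@classical_kerH _ a _ F G) => //.
- move=> x; apply: cderivD; apply/cderivZ/cderiv_real.
    by apply: is_derive_eq (dC x) _; ring.
  by apply: is_derive_eq (dS x) _; ring.
- move=> x.
  have dkS : is_derive x 1 (fun t => - (k * sin (k * t))) (- (k ^+ 2 * cos (k * x))).
    apply: is_derive_eq (is_deriveN (is_derive_mul_fun (is_derive_cst k x 1) (dS x))) _.
    by rewrite /cst; ring.
  have dkC : is_derive x 1 (fun t => k * cos (k * t)) (- (k ^+ 2 * sin (k * x))).
    apply: is_derive_eq (is_derive_mul_fun (is_derive_cst k x 1) (dC x)) _.
    by rewrite /cst; ring.
  have := cderivD (cderivZ A (cderiv_real dkS)) (cderivZ B (cderiv_real dkC)).
  rewrite (_ : A * _ + B * _ = - ((k ^+ 2)%:C * F x))//.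
  by rewrite /F !rmorphN !rmorphM /=; ring.
- rewrite /F mulrN cosN sinN kh_E kha_E rmorphN /= mulrN Bs oppr0 addr0 -AB.
  by rewrite rmorphB /=; ring.
- rewrite /F kh_E kha_E Bs addr0 -AB.
  by rewrite rmorphB /=; ring.
Qed.

Lemma realC_eq0 x : (x%:C == 0 :> R[i]) = (x == 0).
Proof. by rewrite eq_complex /= eqxx andbT. Qed.

Lemma cosDB : cos (u + v) - cos (u - v) = - 2 * (sin u * sin v).
Proof. by rewrite cosD cosB; ring. Qed.

(** First of four cases of the linear system: here [B = 0] and [A] is free. Next, [B] is determined
    by [A] when [sin (u - v) != 0]; then [A = 0] with [B] free; finally both equations are void. *)
Lemma kerH_cos : sin (u + v) != 0 -> sin u * sin v = 0 ->
  forall psi, kerH a (k ^+ 2)%:C psi <-> exists c : R[i], psi = c *: C.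
Proof.
move=> s0 uv0 psi; rewrite kerH_trig cosDB uv0 mulr0; split.
  move=> [A [B [-> /eqP Bs _]]]; exists A.
  by move: Bs; rewrite mulf_eq0 realC_eq0 (negbTE s0) orbF => /eqP ->; rewrite scale0r addr0.
by move=> [c ->]; exists c, 0; rewrite scale0r addr0 !mul0r mulr0.
Qed.

Lemma kerH_mixed : sin (u + v) = 0 -> sin (u - v) != 0 ->
  forall psi, kerH a (k ^+ 2)%:C psi <-> exists c : R[i],
    psi = c *: on_citv (fun x => cos (k * x) +
      (cos (u + v) - cos (u - v)) / sin (u - v) * sin (k * x)).
Proof.
move=> s0 t0 psi.
set q := _ / _.
have E (c : R[i]) : c *: on_citv (fun x => cos (k * x) + q * sin (k * x)) =
    c *: C + (c * q%:C) *: S.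
  apply: trig_combination_eq => x xc; rewrite scaled_on_citv.
    by rewrite on_citv_out// mulr0.
  by rewrite on_citvE// rmorphD rmorphM /=; ring.
have qE : q * sin (u - v) = cos (u + v) - cos (u - v) by rewrite /q divfK.
have t0' : (sin (u - v))%:C != 0 :> R[i] by rewrite realC_eq0.
rewrite kerH_trig s0; split.
  move=> [A [B [-> _ AB]]]; exists A; rewrite E; congr (_ + _ *: _).
  by apply: (mulIf t0'); rewrite -AB -qE rmorphM /= mulrA.
move=> [c ->]; exists c, (c * q%:C); split; [exact: E|by rewrite mulr0|].
by rewrite -qE rmorphM /= mulrA.
Qed.

Lemma kerH_sin : sin (u + v) = 0 -> sin (u - v) = 0 -> sin u * sin v != 0 ->
  forall psi, kerH a (k ^+ 2)%:C psi <-> exists c : R[i], psi = c *: S.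
Proof.
move=> s0 t0 uv0 psi; rewrite kerH_trig s0 t0 cosDB; split.
  move=> [A [B [-> _ /eqP]]]; rewrite mulr0 mulf_eq0 realC_eq0 mulf_eq0 (negbTE uv0).
  by rewrite oppr_eq0 pnatr_eq0 /= orbF => /eqP ->; exists B; rewrite scale0r add0r.
by move=> [c ->]; exists 0, c; rewrite scale0r add0r !mulr0 mul0r.
Qed.

Lemma kerH_both : sin u = 0 -> sin v = 0 ->
  forall psi, kerH a (k ^+ 2)%:C psi <-> exists A B, psi = A *: C + B *: S.
Proof.
move=> u0 v0 psi; rewrite kerH_trig cosDB sinD sinB u0 v0.
rewrite !(mulr0, mul0r, addr0, subr0); split; first by move=> [A [B [-> _ _]]]; exists A, B.
by move=> [A [B ->]]; exists A, B; rewrite !mulr0.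
Qed.

End PositiveEigenvalue.

End BoundaryConditions.

(** * The point spectrum *)

Section Spectrum.
Context {R : realType}.
Implicit Types (psi : R -> R[i]) (phi : R -> R) (x y a k : R) (lambda z A B : R[i]) (m n : nat).
Local Notation h := (pi / 2 : R).
Local Notation U a k := (k * pi * (1 + a) / 4).
Local Notation V a k := (k * pi * (1 - a) / 4).

Lemma sin_pi_int x : sin (x * pi) = 0 -> x \is a Num.int.
Proof.
have pin0 : pi != 0 :> R by rewrite gt_eqF// pi_gt0.
have pos y : 0 < y -> sin (y * pi) = 0 -> y \is a Num.int.
  move=> y0 /sin_eq0_nat[|m _ /(mulIf pin0) ->]; first by rewrite mulr_gt0// pi_gt0.
  exact: intr_nat.
move=> sx; have [x0|x0|->] := ltgtP x 0; [|exact: pos|exact: int_num0].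
by rewrite -rpredN; apply: pos; rewrite ?oppr_gt0// mulNr sinN sx oppr0.
Qed.

Lemma sin_intpi x : x \is a Num.int -> sin (x * pi) = 0.
Proof.
move=> /intrP[[n|n] ->]; first exact: sin_natpi.
by rewrite NegzE rmorphN /= mulNr sinN sin_natpi oppr0.
Qed.

(** One statement for the three families: [b = 1 + a] and [b = 1 - a] give [sigma_p1] and
    [sigma_m1], and [b = 2] gives the nonzero part of [sigma_0]. *)
Lemma sin_eq0_multiple k b : 0 < k -> 0 < b ->
  sin (k * pi * b / 4) = 0 <-> exists2 m, (0 < m)%N & 4 * m%:R / b = k.
Proof.
move=> k0 b0; have pi0 := pi_gt0 R; split.
  move=> /sin_eq0_nat[|m m0 E]; first by rewrite divr_gt0// !mulr_gt0.
  exists m => //; apply: (@mulIf _ pi); first by rewrite gt_eqF.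
  by rewrite mulrAC -[4 * _ * pi]mulrA -E; field; rewrite gt_eqF.
move=> [m _ <-]; rewrite (_ : _ / 4 = m%:R * pi) ?sin_natpi//.
by field; rewrite gt_eqF.
Qed.

(** * Eigenvalues [k ^ 2] with [k > 0]: membership, simplicity, double points *)

Section Positive.
Variables (a k : R).
Hypotheses (ha : -1 < a < 1) (k0 : 0 < k).
Local Notation u := (U a k).
Local Notation v := (V a k).

Lemma sqrC_inj x y : 0 <= x -> 0 <= y -> (x ^+ 2)%:C = (y ^+ 2)%:C :> R[i] -> x = y.
Proof. by move=> x0 y0 [] /eqP; rewrite eqrXn2// => /eqP. Qed.

Lemma sigma_p1P : sigma_p1 a (k ^+ 2)%:C <-> sin u = 0.
Proof.
have a0 : 0 < 1 + a by case/andP: ha => ? ?; lra.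
rewrite sin_eq0_multiple//; split=> -[m m0 E]; exists m => //; last by rewrite E.
by apply: (sqrC_inj _ (ltW k0) E); rewrite divr_ge0 ?mulr_ge0// ltW.
Qed.

Lemma sigma_m1P : sigma_m1 a (k ^+ 2)%:C <-> sin v = 0.
Proof.
have a0 : 0 < 1 - a by case/andP: ha => ? ?; lra.
rewrite sin_eq0_multiple//; split=> -[m m0 E]; exists m => //; last by rewrite E.
by apply: (sqrC_inj _ (ltW k0) E); rewrite divr_ge0 ?mulr_ge0// ltW.
Qed.

Lemma sigma_0P : sigma_0 (k ^+ 2)%:C <-> sin (u + v) = 0.
Proof.
rewrite (_ : u + v = k * pi * 2 / 4); last by field.
rewrite sin_eq0_multiple//; split=> -[m m0 E]; exists m => //.
(* [sigma_0] also contains the index [m = 0], which [k > 0] rules out. *)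
- rewrite lt0n; apply: contraTneq k0 => m00; rewrite m00 in E.
  have := sqrC_inj _ (ltW k0) E; rewrite mulr0 => <-//.
  by rewrite ltxx.
- have <- : 2 * m%:R = k by apply: (sqrC_inj _ (ltW k0) E); rewrite mulr_ge0.
  by field.
- by rewrite -E; congr (_ ^+ 2)%:C; field.
Qed.

Lemma sin0_cos_neq0 x : sin x = 0 -> cos x != 0.
Proof.
move=> s0; apply/eqP => c0; have := cos2Dsin2 x.
by rewrite s0 c0 expr0n addr0 => /esym/eqP; rewrite oner_eq0.
Qed.

(** Where the sine vanishes the cosine does not, so the addition formula can be divided by [cos x].
    This gives the third zero from two among [u], [v], [u + v]. *)
Lemma sin_addr_eq0 x y : sin x = 0 -> sin (x + y) = 0 -> sin y = 0.
Proof.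
move=> s0; rewrite sinD s0 mul0r add0r => /eqP.
by rewrite mulf_eq0 (negbTE (sin0_cos_neq0 s0)) => /eqP.
Qed.

Lemma sigma_m1_p1_sub0 : sin u = 0 -> sin v = 0 -> sin (u + v) = 0.
Proof. by move=> u0 v0; rewrite sinD u0 v0 mul0r mulr0 addr0. Qed.

Lemma cos_unique : sin u = 0 \/ sin v = 0 -> ~ (sin u = 0 /\ sin v = 0) ->
  unique_eigenfunction a (k ^+ 2)%:C (fun x => cos (k * x)) /\
  geom_mult a (k ^+ 2)%:C 1.
Proof.
move=> uv nuv; apply: (one_dimensional_kernel citv0).
  by rewrite mulr0 cos0 oner_neq0.
apply: kerH_cos => //; last by case: uv => ->; rewrite ?mul0r ?mulr0.
apply/eqP => s0; apply: nuv; case: uv => [u0|v0]; split=> //.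
  exact: sin_addr_eq0 u0 s0.
by rewrite addrC in s0; exact: sin_addr_eq0 v0 s0.
Qed.

Lemma mixed_unique : sin (u + v) = 0 -> sin (u - v) != 0 ->
  unique_eigenfunction a (k ^+ 2)%:C (fun x => cos (k * x) +
      (cos (u + v) - cos (u - v)) / sin (u - v) * sin (k * x)) /\
  geom_mult a (k ^+ 2)%:C 1.
Proof.
move=> s0 t0; apply: (one_dimensional_kernel citv0).
  by rewrite mulr0 cos0 sin0 mulr0 addr0 oner_neq0.
exact: kerH_mixed.
Qed.

Lemma citv_sin_neq0 : exists2 x, citv x & sin (k * x) != 0.
Proof.
have h0 := @pihalf_gt0 R; have k1 : 0 < 1 + k by rewrite addr_gt0.
(* This point stays in [citv] for every [k > 0], and [k] times it lies strictly between [0] and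
   [pi / 2]. *)
exists (h / (1 + k)).
  rewrite citvE; apply/andP; split; last first.
    by rewrite ler_pdivrMr// -[leLHS]mulr1 ler_pM2l// lerDl ltW.
  by apply: (@le_trans _ _ 0); [rewrite oppr_le0 ltW|rewrite divr_ge0// ltW].
rewrite gt_eqF//; apply: sin_gt0_pihalf; apply/andP; split.
  by rewrite mulr_gt0// divr_gt0.
by rewrite mulrA ltr_pdivrMr// mulrC ltr_pM2l// ltrDr ltr01.
Qed.

Lemma sin_unique : sin (u + v) = 0 -> sin (u - v) = 0 -> ~ (sin u = 0 /\ sin v = 0) ->
  unique_eigenfunction a (k ^+ 2)%:C (fun x => sin (k * x)) /\
  geom_mult a (k ^+ 2)%:C 1.
Proof.
move=> s0 t0 nuv; have [x xc sx] := citv_sin_neq0.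
apply: (one_dimensional_kernel xc) => //; apply: kerH_sin => //.
apply/eqP => /eqP; rewrite mulf_eq0 => /orP[] /eqP z0; apply: nuv; split=> //.
  exact: sin_addr_eq0 z0 s0.
by rewrite addrC in s0; exact: sin_addr_eq0 z0 s0.
Qed.

Lemma geom_mult_simple : [\/ sin u = 0, sin v = 0 | sin (u + v) = 0] ->
  ~ (sin u = 0 /\ sin v = 0) -> geom_mult a (k ^+ 2)%:C 1.
Proof.
case=> [u0|v0|s0] nuv.
- exact: (cos_unique (or_introl u0) nuv).2.
- exact: (cos_unique (or_intror v0) nuv).2.
have [t0|t0] := eqVneq (sin (u - v)) 0; first exact: (sin_unique s0 t0 nuv).2.
exact: (mixed_unique s0 t0).2.
Qed.

Lemma double_eigenvalue : sin u = 0 -> sin v = 0 ->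
  let s := on_citv (fun x => sin (k * x)) in
  let c := on_citv (fun x => cos (k * x)) in
  [/\ geom_mult a (k ^+ 2)%:C 2, eigenfunction a (k ^+ 2)%:C s,
      eigenfunction a (k ^+ 2)%:C c & lin_indep [:: s; c]].
Proof.
move=> u0 v0 s c; have ker := kerH_both ha k0 u0 v0.
have lcE (d : 'I_2 -> R[i]) : lin_comb (s := [:: s; c]) d = d ord_max *: c + d ord0 *: s.
  rewrite /lin_comb big_ord_recl big_ord1 /= addrC; congr (d _ *: _ + _).
  exact/val_inj.
have [x xc sx] := citv_sin_neq0.
have indep : lin_indep [:: s; c].
  move=> d; rewrite lcE => H.
  (* Evaluation at [0] isolates the cosine coefficient; a point with nonzero sine then removes the
     other. *)
  have d1 : d ord_max = 0.
    have := congr1 (fun f => f 0) H; rewrite !fctE /s /c !on_citvE; try exact: citv0.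
    by rewrite mulr0 cos0 sin0 scaler0 addr0 [_ *: _]mulr1.
  have d0 : d ord0 = 0.
    move: H; rewrite d1 scale0r add0r => /(congr1 (fun f => f x)).
    rewrite fctE /s on_citvE// => /eqP; rewrite scaler_eq0 => /orP[/eqP//|].
    by rewrite realC_eq0 (negbTE sx).
  move=> i; have [->//|->//] : i = ord0 \/ i = ord_max.
  by case: i => -[|[|//]] i; [left|right]; apply/val_inj.
split=> //.
- exists [:: s; c]; split=> //; apply/seteqP; split=> psi.
    move=> /ker[A [B ->]]; exists (fun i : 'I_2 => if i == ord0 then B else A) => //.
  by move=> [d _ <-]; rewrite lcE; apply/ker; exists (d ord_max), (d ord0).
- split; last exact: on_citv_neq0 xc sx.
  by apply/ker; exists 0, 1; rewrite scale0r add0r scale1r.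
- split; first by apply/ker; exists 1, 0; rewrite scale0r addr0 scale1r.
  by apply: (on_citv_neq0 citv0); rewrite mulr0 cos0 oner_neq0.
Qed.

Lemma point_spectrum_pos : [\/ sin u = 0, sin v = 0 | sin (u + v) = 0] ->
  point_spectrum a (k ^+ 2)%:C.
Proof.
have wit phi x : citv x -> phi x != 0 -> unique_eigenfunction a (k ^+ 2)%:C phi ->
    point_spectrum a (k ^+ 2)%:C.
  move=> xc px ue; exists (on_citv phi); apply/ue.
  by exists 1; rewrite ?scale1r ?oner_neq0.
have [[u0 v0] _|nuv] := pselect (sin u = 0 /\ sin v = 0).
  by have [_ _ ? _] := double_eigenvalue u0 v0; exists (on_citv (fun x => cos (k * x))).
have cosw : sin u = 0 \/ sin v = 0 -> point_spectrum a (k ^+ 2)%:C.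
  move=> uv; apply: (wit _ _ citv0 _ (cos_unique uv nuv).1).
  by rewrite mulr0 cos0 oner_neq0.
case=> [u0|v0|s0]; [by apply: cosw; left|by apply: cosw; right|].
have [t0|t0] := eqVneq (sin (u - v)) 0.
  by have [x xc sx] := citv_sin_neq0; exact: (wit _ _ xc sx (sin_unique s0 t0 nuv).1).
apply: (wit _ _ citv0 _ (mixed_unique s0 t0).1).
by rewrite mulr0 cos0 sin0 mulr0 addr0 oner_neq0.
Qed.

(** Eliminating [k] from [4 m = k (1 + a)] and [4 n = k (1 - a)] gives [a = (m - n) / (m + n)]. *)
Lemma sin0_rational : sin u = 0 -> sin v = 0 -> rational a.
Proof.
have /andP[a1' a2'] := ha.
have a1 : 0 < 1 + a by lra.
have a2 : 0 < 1 - a by lra.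
move=> /(sin_eq0_multiple k0 a1)[m m0 mk] /(sin_eq0_multiple k0 a2)[n n0 nk].
apply/rationalP; exists (m%:Z - n%:Z), (m + n)%N.
have mn : (m + n)%:R != 0 :> R by rewrite pnatr_eq0 -lt0n addn_gt0 m0.
apply: (mulIf mn); rewrite divfK// rmorphB /= natrD.
have E : m%:R * (1 - a) = n%:R * (1 + a).
  apply: (@mulfI _ 4); rewrite ?pnatr_eq0// !mulrA.
  have -> : 4 * m%:R = k * (1 + a) by rewrite -mk divfK// gt_eqF.
  have -> : 4 * n%:R = k * (1 - a) by rewrite -nk divfK// gt_eqF.
  by ring.
by rewrite -!pmulrn; lra.
Qed.

End Positive.

(** * The eigenvalue zero and the determination of the point spectrum *)

Lemma kerH_zero a : -1 < a < 1 -> forall psi,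
  kerH a 0 psi <-> exists c : R[i], psi = c *: on_citv (fun=> 1).
Proof.
move=> ha psi; have [c1 c2 c3] := citv_bounds ha; split.
  move=> kp; have [[_ [_ out] b1 b2] _ _] := kp.
  have [A [B psiE]] := kerH_affine kp.
  have B0 : B = 0.
    move: b1; rewrite b2 !psiE// rmorphN /= mulrN => /addrI /eqP.
    rewrite eq_sym -addr_eq0 -mulr2n mulrn_eq0 /= mulf_eq0.
    by rewrite realC_eq0 (gt_eqF (@pihalf_gt0 R)) orbF => /eqP.
  exists A; apply/funext => x; rewrite scaled_on_citv.
  have [xc|xc] := pselect (citv x); last by rewrite out// on_citv_out// mulr0.
  by rewrite psiE// on_citvE// B0 mul0r addr0 mulr1.
move=> [c ->].
have -> : c *: on_citv (fun=> 1) = patch (fun=> 0) citv (fun=> c).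
  apply/funext => x; rewrite scaled_on_citv.
  have [xc|xc] := pselect (citv x); first by rewrite on_citvE// patch_citv// mulr1.
  by rewrite on_citv_out// patchN ?mulr0// notin_setE.
apply: (@classical_kerH _ _ _ _ (fun=> 0)) => // x; first exact: cderiv_cst.
by rewrite mul0r oppr0; exact: cderiv_cst.
Qed.

Lemma zero_unique a : -1 < a < 1 -> unique_eigenfunction a 0 (fun=> 1) /\ geom_mult a 0 1.
Proof.
move=> ha; apply: (one_dimensional_kernel citv0); first exact: oner_neq0.
exact: kerH_zero.
Qed.

Lemma point_spectrum_sub a : -1 < a < 1 ->
  point_spectrum a `<=` sigma_m1 a `|` sigma_p1 a `|` sigma_0.
Proof.
move=> ha lambda [psi [kp psi0]].
have [->|l0] := eqVneq lambda 0; first by right; exists 0%N => //; rewrite mulr0 expr0n.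
have [c1 c2 c3] := citv_bounds ha; have pi0 := pi_gt0 R; have /andP[a1 a2] := ha.
have [k k2] : exists k : R[i], k ^+ 2 = lambda by exists (sqrtc lambda); exact: sqr_sqrtc.
subst lambda; have k0 : k != 0 by move: l0; rewrite sqrf_eq0.
have [[_ [_ out] b1 b2] _ _] := kp.
have [A [B psiE]] := kerH_exponential k0 kp.
have AB : ~ (A = 0 /\ B = 0).
  move=> [A0 B0]; apply: psi0; apply/funext => x.
  have [xc|/out//] := pselect (citv x).
  by rewrite psiE// A0 B0 !mul0r addr0.
have freq (b c : R) : 0 < c -> 2 * b * pi / (h * c) = 4 * b / c.
  by move: (pi : R) pi0 => p p0 c0; field; rewrite !gt_eqF.
have root c : 0 < c -> cexpi k (h * c) = 1 ->
    exists2 m, (0 < m)%N & ((4 * m%:R / c) ^+ 2)%:C = k ^+ 2.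
  move=> c0 /cexpi_eq1[||m m0 kE]//; first by rewrite mulr_gt0// pihalf_gt0.
  by exists m => //; rewrite kE freq.
set z := cexpi k h; set w := cexpi k (h * a).
have z0 : z != 0 by exact: cexpi_neq0.
have w0 : w != 0 by exact: cexpi_neq0.
move: b1 b2; rewrite !psiE// opprK !cexpiN -/z -/w => b1 b2.
(* The condition that the values at [-h] and [h] agree, multiplied by [z] to clear the inverse. *)
have zE : (A - B) * (z ^+ 2 - 1) = 0.
  transitivity (z * ((A * z + B / z) - (A * z^-1 + B * z))); first by field.
  by rewrite b1 b2 subrr mulr0.
move/eqP: zE; rewrite mulf_eq0 !subr_eq0 => /orP[/eqP ABe|/eqP z1].
  have A0 : A != 0 by apply/eqP => A0; apply: AB; rewrite -ABe.
  have : (z - w) * (z * w - 1) = 0.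
    apply: (mulfI A0); rewrite mulr0.
    transitivity (z * w * ((A * z + A / z) - (A * w + A / w))); first by field; rewrite z0 w0.
    by move: b2; rewrite ABe => <-; rewrite subrr mulr0.
  (* [z = w] reads [exp(ikh(1 - a)) = 1] and leads to [sigma_m1]; [z w = 1] reads
     [exp(ikh(1 + a)) = 1] and leads to [sigma_p1]. *)
  move=> /eqP; rewrite mulf_eq0 !subr_eq0 => /orP[/eqP zw|/eqP zw]; left.
    left; apply: root; first by lra.
    by rewrite mulrBr mulr1 cexpiD cexpiN -/z -/w zw divff.
  by right; apply: root; rewrite ?mulrDr ?mulr1 ?cexpiD//; lra.
right; have [||m m0 kE] := root 2; rewrite ?ltr0n//.
  by rewrite mulr_natr mulr2n cexpiD.
by exists m => //; rewrite -kE; congr (_ ^+ 2)%:C; field.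
Qed.

Lemma sigma_cases a lambda : -1 < a < 1 ->
  (sigma_m1 a `|` sigma_p1 a `|` sigma_0) lambda ->
  lambda = 0 \/ exists k, [/\ 0 < k, lambda = (k ^+ 2)%:C &
    [\/ sin (U a k) = 0, sin (V a k) = 0 | sin (U a k + V a k) = 0]].
Proof.
move=> ha; have /andP[a1' a2'] := ha.
have a1 : 0 < 1 + a by lra.
have a2 : 0 < 1 - a by lra.
have pos m : (0 < m)%N -> 0 < 4 * m%:R :> R by move=> m0; rewrite mulr_gt0// ltr0n.
move=> [[]|] [m m0 <-].
- right; exists (4 * m%:R / (1 - a)); have kp := divr_gt0 (pos m m0) a2.
  by split=> //; apply: Or32; apply/(sin_eq0_multiple kp a2); exists m.
- right; exists (4 * m%:R / (1 + a)); have kp := divr_gt0 (pos m m0) a1.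
  by split=> //; apply: Or31; apply/(sin_eq0_multiple kp a1); exists m.
- have [->|mn0] := posnP m; first by left; rewrite mulr0 expr0n.
  right; exists (2 * m%:R); have kp : 0 < 2 * m%:R :> R by rewrite mulr_gt0// ltr0n.
  split=> //; apply: Or33; rewrite (_ : _ + _ = m%:R * pi) ?sin_natpi//.
  by field.
Qed.

Lemma point_spectrumE a : -1 < a < 1 ->
  point_spectrum a = sigma_m1 a `|` sigma_p1 a `|` sigma_0.
Proof.
move=> ha; apply/seteqP; split; first exact: point_spectrum_sub.
move=> lambda /(sigma_cases ha)[->|[k [k0 -> /point_spectrum_pos]]]; last exact.
exists (on_citv (fun=> 1)); apply/(zero_unique ha).1.
by exists 1; rewrite ?scale1r ?oner_neq0.
Qed.

End Spectrum.

Theorem proposition1 (R : realType) (a : R) (ha : -1 < a < 1) :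
  point_spectrum a = sigma_m1 a `|` sigma_p1 a `|` sigma_0
  /\
  (irrational a ->
     [/\ sigma_m1 a `&` sigma_p1 a = set0,
         sigma_m1 a `&` sigma_0 = set0 &
         sigma_p1 a `&` sigma_0 = set0] /\
     (forall lambda, point_spectrum a lambda -> geom_mult a lambda 1) /\
     [/\ forall m : nat, (0 < m)%N ->
           unique_eigenfunction a ((4 * m%:R / (1 - a)) ^+ 2)%:C (cos_m1 a m),
         forall m : nat, (0 < m)%N ->
           unique_eigenfunction a ((4 * m%:R / (1 + a)) ^+ 2)%:C (cos_p1 a m),
         forall m : nat, (0 < m)%N ->
           sin (m%:R * pi * a) != 0 /\
           unique_eigenfunction a ((2 * m%:R) ^+ 2)%:C (mixed_0 a m) &
         unique_eigenfunction a 0 (fun=> 1)])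
  /\
  (rational a ->
     [/\ sigma_m1 a `&` sigma_p1 a = sigma_m1 a `&` sigma_p1 a `&` sigma_0,
         sigma_m1 a `&` sigma_p1 a !=set0,
         forall k : R, 0 < k -> (sigma_m1 a `&` sigma_p1 a) (k ^+ 2)%:C ->
           let s := on_citv (fun x => sin (k * x)) in
           let c := on_citv (fun x => cos (k * x)) in
           [/\ geom_mult a (k ^+ 2)%:C 2,
               eigenfunction a (k ^+ 2)%:C s,
               eigenfunction a (k ^+ 2)%:C c &
               lin_indep [:: s; c]],
         forall lambda : R[i],
           point_spectrum a lambda -> ~ (sigma_m1 a `&` sigma_p1 a) lambda ->
           geom_mult a lambda 1 /\
           [/\ forall m : nat, (0 < m)%N ->
                 lambda = ((4 * m%:R / (1 - a)) ^+ 2)%:C ->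
                 unique_eigenfunction a lambda (cos_m1 a m),
               forall m : nat, (0 < m)%N ->
                 lambda = ((4 * m%:R / (1 + a)) ^+ 2)%:C ->
                 unique_eigenfunction a lambda (cos_p1 a m),
               forall m : nat, (0 < m)%N ->
                 lambda = ((2 * m%:R) ^+ 2)%:C ->
                 m%:R * a \isn't a Num.int ->
                 sin (m%:R * pi * a) != 0 /\
                 unique_eigenfunction a lambda (mixed_0 a m) &
               forall m : nat, (0 < m)%N ->
                 lambda = ((2 * m%:R) ^+ 2)%:C ->
                 m%:R * a \is a Num.int ->
                 (exists j : int, m%:R * (1 + a) = (2 * j + 1)%:~R) ->
                 unique_eigenfunction a lambda (fun x => sin (2 * m%:R * x))] &
         geom_mult a 0 1 /\ unique_eigenfunction a 0 (fun=> 1)]).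
Proof.
have /andP[ha1 ha2] := ha.
have a1 : 0 < 1 + a by lra.
have a2 : 0 < 1 - a by lra.
have pos4 (m : nat) c : (0 < m)%N -> 0 < c -> 0 < 4 * m%:R / c.
  by move=> m0 c0; rewrite divr_gt0// mulr_gt0// ltr0n.
have pos2 (m : nat) : (0 < m)%N -> 0 < 2 * m%:R :> R.
  by move=> m0; rewrite mulr_gt0// ltr0n.
have sm1 k : 0 < k -> sigma_m1 a (k ^+ 2)%:C <-> sin (k * pi * (1 - a) / 4) = 0 by exact: sigma_m1P.
have sp1 k : 0 < k -> sigma_p1 a (k ^+ 2)%:C <-> sin (k * pi * (1 + a) / 4) = 0 by exact: sigma_p1P.
have both k : 0 < k -> (sigma_m1 a `&` sigma_p1 a) (k ^+ 2)%:C <->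
    sin (k * pi * (1 + a) / 4) = 0 /\ sin (k * pi * (1 - a) / 4) = 0.
  by move=> k0; split=> [[/(sm1 _ k0) ? /(sp1 _ k0) ?]|[/(sp1 _ k0) ? /(sm1 _ k0) ?]].
have pos_m1 lambda : sigma_m1 a lambda -> exists2 k, 0 < k & lambda = (k ^+ 2)%:C.
  by move=> [m m0 <-]; exists (4 * m%:R / (1 - a)) => //; exact: pos4.
have pos_p1 lambda : sigma_p1 a lambda -> exists2 k, 0 < k & lambda = (k ^+ 2)%:C.
  by move=> [m m0 <-]; exists (4 * m%:R / (1 + a)) => //; exact: pos4.
have m1_0 k : 0 < k -> sigma_m1 a (k ^+ 2)%:C -> sigma_0 (k ^+ 2)%:C ->
    sigma_p1 a (k ^+ 2)%:C.
  move=> k0 /(sm1 _ k0) v0 /(sigma_0P a k0) s0; apply/(sp1 _ k0).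
  by apply: sin_addr_eq0 v0 _; rewrite addrC.
have p1_0 k : 0 < k -> sigma_p1 a (k ^+ 2)%:C -> sigma_0 (k ^+ 2)%:C ->
    sigma_m1 a (k ^+ 2)%:C.
  move=> k0 /(sp1 _ k0) u0 /(sigma_0P a k0) s0; apply/(sm1 _ k0).
  exact: sin_addr_eq0 u0 s0.
have mk k : 0 < k -> sigma_m1 a (k ^+ 2)%:C -> ~ (sigma_m1 a `&` sigma_p1 a) (k ^+ 2)%:C ->
    unique_eigenfunction a (k ^+ 2)%:C (fun x => cos (k * x)).
  move=> k0 /(sm1 _ k0) v0 /(both _ k0) nb.
  exact: (cos_unique ha k0 (or_intror v0) nb).1.
have pk k : 0 < k -> sigma_p1 a (k ^+ 2)%:C -> ~ (sigma_m1 a `&` sigma_p1 a) (k ^+ 2)%:C ->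
    unique_eigenfunction a (k ^+ 2)%:C (fun x => cos (k * x)).
  move=> k0 /(sp1 _ k0) u0 /(both _ k0) nb.
  exact: (cos_unique ha k0 (or_introl u0) nb).1.
have uvD m : 2 * m%:R * pi * (1 + a) / 4 + 2 * m%:R * pi * (1 - a) / 4 = m%:R * pi.
  by move: (pi : R) => p; field.
have uvB m : 2 * m%:R * pi * (1 + a) / 4 - 2 * m%:R * pi * (1 - a) / 4 = m%:R * pi * a.
  by move: (pi : R) => p; field.
have mixed (m : nat) : (0 < m)%N -> sin (m%:R * pi * a) != 0 ->
    unique_eigenfunction a ((2 * m%:R) ^+ 2)%:C (mixed_0 a m).
  move=> m0 sa; have := mixed_unique ha (pos2 m m0).
  by rewrite uvD uvB sin_natpi => /(_ erefl sa)[].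
have simple lambda : point_spectrum a lambda -> ~ (sigma_m1 a `&` sigma_p1 a) lambda ->
    geom_mult a lambda 1.
  rewrite point_spectrumE// => /(sigma_cases ha)[-> _|[k [k0 -> sk]] /(both _ k0) nb].
    exact: (zero_unique ha).2.
  exact: (geom_mult_simple ha k0 sk nb).
have [zu zg] := zero_unique ha.
split; first exact: point_spectrumE.
split.
- move=> ia.
  have disj : sigma_m1 a `&` sigma_p1 a = set0.
    apply/seteqP; split=> // lambda lmp; apply: ia; have [lm _] := lmp.
    have [k k0 lE] := pos_m1 _ lm; move: lmp; rewrite lE => /(both _ k0)[u0 v0].
    exact: sin0_rational k0 u0 v0.
  have nb lambda : ~ (sigma_m1 a `&` sigma_p1 a) lambda by rewrite disj.
  split; last split.
  + split=> //; apply/seteqP; split=> // lambda [l1 l0]; apply: (nb lambda).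
      have [k k0 lE] := pos_m1 _ l1; rewrite lE in l1 l0 *; split=> //.
      exact: m1_0.
    have [k k0 lE] := pos_p1 _ l1; rewrite lE in l1 l0 *; split=> //.
    exact: p1_0.
  + by move=> lambda ps; exact: simple.
  + split=> [m m0|m m0|m m0|]; last exact: zu.
    * by apply: mk; [exact: pos4|exists m|exact: nb].
    * by apply: pk; [exact: pos4|exists m|exact: nb].
    (* A zero would make [m a] an integer [n], hence [a = n / m] rational. *)
    * have sa : sin (m%:R * pi * a) != 0.
        apply/eqP; rewrite mulrAC => /sin_pi_int/intrP[n maE]; apply: ia.
        apply/rationalP; exists n, m; rewrite -maE mulrAC mulfV ?mul1r//.
        by rewrite pnatr_eq0 -lt0n.
      by split=> //; exact: mixed.
- move=> ra; split.
  + apply/seteqP; split=> lambda; last by case.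
    move=> lmp; split=> //; have [lm _] := lmp; have [k k0 lE] := pos_m1 _ lm.
    move: lmp; rewrite lE => /(both _ k0)[u0 v0]; apply/(sigma_0P a k0).
    exact: sigma_m1_p1_sub0.
  + have /rationalP[p [q0 aE]] := ra.
    (* The denominator [q0] may be zero; since the inverse of [0] is [0], then [a = 0] and [q = 1]
       serves. *)
    have [q [q1 qa]] : exists q : nat, (0 < q)%N /\ q%:R * a \is a Num.int.
      have [q00|q0p] := posnP q0.
        by exists 1%N; split=> //; rewrite aE q00 invr0 !mulr0; exact: int_num0.
      exists q0; split=> //; rewrite aE mulrC divfK ?intr_int//.
      by rewrite pnatr_eq0 -lt0n.
    (* For [k = 4 q] the phases [u] and [v] are [(q + q a) pi] and [(q - q a) pi], both integer
       multiples of [pi]. *)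
    have k0 : 0 < 4 * q%:R :> R by rewrite mulr_gt0// ltr0n.
    exists ((4 * q%:R) ^+ 2)%:C; apply/(both _ k0); split.
      rewrite (_ : _ / 4 = (q%:R + q%:R * a) * pi); last by move: (pi : R) => p'; field.
      by apply: sin_intpi; rewrite rpredD// intr_nat.
    rewrite (_ : _ / 4 = (q%:R - q%:R * a) * pi); last by move: (pi : R) => p'; field.
    by apply: sin_intpi; rewrite rpredB// intr_nat.
  + by move=> k k0 /(both _ k0)[u0 v0]; exact: double_eigenvalue.
  + move=> lambda ps nb; split; first exact: simple.
    split=> m m0 lE; move: nb; rewrite lE => nb.
    * by apply: mk => //; [exact: pos4|exists m].
    * by apply: pk => //; [exact: pos4|exists m].
    * move=> ma; have sa : sin (m%:R * pi * a) != 0.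
        by apply: contraNneq ma; rewrite mulrAC => /sin_pi_int.
      by split=> //; exact: mixed.
    * move=> ma _; have k0 := pos2 m m0.
      apply: (sin_unique ha k0 _ _ _).1; last by move/(both _ k0).
        by rewrite uvD sin_natpi.
      by rewrite uvB mulrAC sin_intpi.
  + by [].
Qed.
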